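(* For all infinite compact Hausdorff spaces $K_1$ and $K_2$, the space $(C(K_1)\widehat{\otimes}_\pi C(K_2))^{**}$ does not have the Dunford-Pettis property.
   Context: $C(K)$ is the Banach space of continuous scalar functions on the compact Hausdorff space $K$ with the supremum norm. $E\widehat{\otimes}_\pi F$ is the (completed) projective tensor product, and $X^{**}$ is the bidual of $X$. An operator (bounded linear map) is completely continuous if it takes weak Cauchy sequences into norm Cauchy sequences. A Banach space $E$ has the Dunford-Pettis property if every weakly compact operator from $E$ into any Banach space is completely continuous; equivalently, $\lim_n\phi_n(x_n)=0$ for all weakly null sequences $(x_n)\subset E$ and $(\phi_n)\subset E^*$. *)

(* Defs.v *)
From HB Require Import structures.
From mathcomp Require Import all_boot all_order all_algebra.
From mathcomp Require Import complex.
From mathcomp Require Import boolp classical_sets functions cardinality reals.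
From mathcomp Require Import topology normedtype.

Set Implicit Arguments.
Unset Strict Implicit.
Unset Printing Implicit Defensive.

Import Order.TTheory GRing.Theory Num.Theory.

Local Open Scope classical_set_scope.
Local Open Scope ring_scope.

(* In MathComp-Analysis the norm of a normed module over K takes its values in
   K itself.  A scalar field is a field K in which suprema of bounded sets of
   nonnegative elements exist, so that sup norms and operator norms can be
   formed; R and R[i] are scalar fields for every R : realType. *)
HB.mixin Record NumField_isScalarField K of Num.NumField K := {
  nneg_supremums : forall A : set K, A !=set0 -> (forall x, A x -> 0 <= x) ->
    has_ubound A -> supremums A !=set0
}.

#[short(type="scalarFieldType")]
HB.structure Definition ScalarField :=
  {K of Num.NumField K & NumField_isScalarField K}.

Section real_scalars.
Variable R : realType.

Lemma real_nneg_supremums (A : set R) : A !=set0 -> (forall x, A x -> 0 <= x) ->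
  has_ubound A -> supremums A !=set0.
Proof.
move=> A0 _ ubA; exists (sup A); split; first exact: sup_upper_bound.
by move=> y yA; apply: ge_sup.
Qed.

#[non_forgetful_inheritance]
HB.instance Definition _ := NumField_isScalarField.Build R real_nneg_supremums.

End real_scalars.

Section complex_scalars.
Variable R : realType.
Local Open Scope complex_scope.

Lemma complex_nneg_supremums (A : set R[i]) :
  A !=set0 -> (forall x, A x -> 0 <= x) ->
  has_ubound A -> supremums A !=set0.
Proof.
move=> [a Aa] A0 [M AM].
have realA x : A x -> x = (complex.Re x)%:C.
  by case: x => x y /A0; rewrite lecE /= => /andP[/eqP -> _].
have sRe : has_sup [set complex.Re x | x in A].
  split; first by exists (complex.Re a), a.
  by exists (complex.Re M) => _ [x Ax <-]; have := AM _ Ax; rewrite lecE => /andP[].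
exists (sup [set complex.Re x | x in A])%:C; split.
  move=> x Ax; rewrite (realA _ Ax) lecR.
  by apply: sup_upper_bound => //; exists x.
move=> y yA; have := yA _ Aa; rewrite (realA _ Aa) lecE /= => /andP[/eqP yi _].
rewrite lecE /= yi eqxx /=; apply: ge_sup; first exact: sRe.1.
by move=> _ [x Ax <-]; have := yA _ Ax; rewrite lecE => /andP[].
Qed.

HB.instance Definition _ :=
  NumField_isScalarField.Build R[i] complex_nneg_supremums.

End complex_scalars.

Section supremum_theory.
Variables (K : scalarFieldType) (A : set K).
Hypotheses (A0 : A !=set0) (Age0 : forall x, A x -> 0 <= x).
Hypothesis (ubA : has_ubound A).

Lemma nneg_supremumP : supremums A (supremum 0 A).
Proof.
have sA := nneg_supremums _ A0 Age0 ubA.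
rewrite /supremum; case: ifPn => [/eqP A_eq0|_]; last exact: xgetPex.
by case: A0 => x; rewrite A_eq0.
Qed.

Lemma nneg_supremum_ub x : A x -> x <= supremum 0 A.
Proof. exact: nneg_supremumP.1. Qed.

Lemma nneg_supremum_le y : (forall x, A x -> x <= y) -> supremum 0 A <= y.
Proof. by move=> Ay; exact: nneg_supremumP.2. Qed.

End supremum_theory.

Section continuous_functions.
Variables (K : scalarFieldType) (T : topologicalType).

Definition continuous_pred : {pred T -> K^o} :=
  [pred f | `[< continuous (f : T -> K^o) >]].

Lemma continuous_submod_closed : GRing.submod_closed continuous_pred.
Proof.
split=> [|a f g]; rewrite !inE; first by move=> x; exact: cvg_cst.
move=> cf cg x.
by apply: cvgD; [apply: cvgZr; exact: cf|exact: cg].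
Qed.
HB.instance Definition _ := GRing.isSubmodClosed.Build K (T -> K^o)
  continuous_pred continuous_submod_closed.

(* C(T) for compact T; the proof of compactness is a parameter of the type
   because the sup norm is finite only on a compact space. *)
Record contfun (cT : compact [set: T]) := Contfun {
  contfun_val :> T -> K^o;
  _ : contfun_val \in continuous_pred }.

Variable cT : compact [set: T].

HB.instance Definition _ := [isSub for @contfun_val cT].
HB.instance Definition _ := [Choice of contfun cT by <:].
HB.instance Definition _ := [SubChoice_isSubLmodule of contfun cT by <:].

Implicit Types f g : contfun cT.

Lemma contfun_continuous f : continuous (f : T -> K^o).
Proof. by case: f => f /= /[!inE]. Qed.

Lemma contfun_norm_ub f : has_ubound (range (fun t => `|f t|)).
Proof.
have /compact_near_coveringP/(_ _ +oo_K (fun M t => `|f t| <= M)) := cT.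
case=> [t _|M [Mreal fM]]; last first.
  by exists (M + 1) => _ [t _ <-]; apply: fM; rewrite ?ltrDl.
near=> u M => /=; apply: (@le_trans _ _ (`|f t| + 1)).
  near: u; apply: (cvgr_norm_le (f t)); last by rewrite ltrDl.
  exact: contfun_continuous.
near: M; apply: nbhs_pinfty_ge; rewrite realD ?normr_real//.
Unshelve. all: by end_near. Qed.

Definition supnorm f : K := supremum 0 (range (fun t => `|f t|)).

Lemma le_supnorm f t : `|f t| <= supnorm f.
Proof.
apply: nneg_supremum_ub; last by exists t.
- by exists `|f t|, t.
- by move=> _ [u _ <-].
- exact: contfun_norm_ub.
Qed.

Lemma supnorm_le f (M : K) :
  0 <= M -> (forall t, `|f t| <= M) -> supnorm f <= M.
Proof.
move=> M0 fM; have [rf0|] := eqVneq (range (fun t => `|f t|)) set0.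
  by rewrite /supnorm rf0 supremum0.
move=> /set0P rf; apply: nneg_supremum_le => //.
- by move=> _ [u _ <-].
- exact: contfun_norm_ub.
- by move=> _ [u _ <-].
Qed.

Lemma supnorm_ge0 f : 0 <= supnorm f.
Proof.
have [rf0|] := eqVneq (range (fun t => `|f t|)) set0.
  by rewrite /supnorm rf0 supremum0.
by move=> /set0P[_ [t _ _]]; exact: le_trans (le_supnorm f t).
Qed.

Let supnormD f g : supnorm (f + g) <= supnorm f + supnorm g.
Proof.
apply: supnorm_le => [|t]; first by rewrite addr_ge0 ?supnorm_ge0.
by rewrite (le_trans (ler_normD _ _))// lerD ?le_supnorm.
Qed.

Let supnormZ (a : K) f : supnorm (a *: f) = `|a| * supnorm f.
Proof.
have leZ b g : supnorm (b *: g) <= `|b| * supnorm g.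
  apply: supnorm_le => [|t]; first by rewrite mulr_ge0 ?supnorm_ge0.
  by rewrite normrM ler_wpM2l ?le_supnorm.
have [->|a0] := eqVneq a 0.
  rewrite scale0r normr0 mul0r; apply/le_anti; rewrite supnorm_ge0 andbT.
  by apply: supnorm_le => // t; rewrite normr0.
apply/le_anti; rewrite leZ /= -ler_pdivlMl ?normr_gt0//.
by rewrite -{1}[f](scalerK a0) -normfV leZ.
Qed.

Let supnorm_eq0 f : supnorm f = 0 -> f = 0.
Proof.
move=> f0; apply/val_inj/funext => t /=; apply/eqP; rewrite -normr_le0.
by rewrite -f0 le_supnorm.
Qed.

HB.instance Definition _ := Lmodule_isNormed.Build K (contfun cT)
  supnormD supnormZ supnorm_eq0.

End continuous_functions.

Section dual_space.
Variables (K : scalarFieldType) (V : normedModType K).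

Definition dual_pred : {pred V -> K^o} :=
  [pred f | `[< linear (f : V -> K^o) /\ continuous (f : V -> K^o) >]].

Lemma dual_submod_closed : GRing.submod_closed dual_pred.
Proof.
split=> [|a f g]; rewrite !inE.
  split=> [b x y|x]; last exact: cvg_cst.
  by rewrite /= scaler0 addr0.
move=> [lf cf] [lg cg]; split=> [b x y|x].
  rewrite !fctE lf lg !scalerDr !scalerA (mulrC a b) -!addrA; congr (_ + _).
  by rewrite addrCA.
by apply: cvgD; [apply: cvgZr; exact: cf|exact: cg].
Qed.
HB.instance Definition _ := GRing.isSubmodClosed.Build K (V -> K^o)
  dual_pred dual_submod_closed.

Record dual := Dual {
  dual_val :> V -> K^o;
  _ : dual_val \in dual_pred }.

HB.instance Definition _ := [isSub for dual_val].
HB.instance Definition _ := [Choice of dual by <:].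
HB.instance Definition _ := [SubChoice_isSubLmodule of dual by <:].

Implicit Types f g : dual.

Lemma dual_linear f : linear (f : V -> K^o).
Proof. by case: f => f /= /[!inE] -[]. Qed.

Lemma dual_continuous f : continuous (f : V -> K^o).
Proof. by case: f => f /= /[!inE] -[]. Qed.

HB.instance Definition _ f :=
  GRing.isLinear.Build K V K^o *:%R (dual_val f) (dual_linear f).

Definition opnorm f : K :=
  supremum 0 [set `|f x| | x in [set x : V | `|x| <= 1]].

Lemma dual_norm_ub f :
  has_ubound [set `|f x| | x in [set x : V | `|x| <= 1]].
Proof.
have : bounded_near f (nbhs (0 : V)).
  exact/linear_bounded_continuous/dual_continuous.
move=> /bounded_funP /(_ 1)[M fM].
by exists M => _ [x x1 <-]; exact: fM.
Qed.

Lemma le_opnorm1 f x : `|x| <= 1 -> `|f x| <= opnorm f.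
Proof.
move=> x1; apply: nneg_supremum_ub; last by exists x.
- by exists `|f x|, x.
- by move=> _ [u _ <-].
- exact: dual_norm_ub.
Qed.

Lemma opnorm_ge0 f : 0 <= opnorm f.
Proof. by apply: le_trans (le_opnorm1 f (x := 0) _); rewrite ?normr0. Qed.

Lemma le_opnorm f x : `|f x| <= opnorm f * `|x|.
Proof.
have [->|x0] := eqVneq x 0; first by rewrite linear0 !normr0 mulr0.
rewrite -ler_pdivrMr ?normr_gt0// mulrC -[_^-1]ger0_norm ?invr_ge0//.
rewrite -normrZ -linearZ le_opnorm1// normrZ ger0_norm ?invr_ge0//.
by rewrite mulVf ?normr_eq0.
Qed.

Lemma opnorm_le f (M : K) :
  0 <= M -> (forall x, `|x| <= 1 -> `|f x| <= M) -> opnorm f <= M.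
Proof.
move=> M0 fM; apply: nneg_supremum_le.
- by exists `|f 0|, 0 => //=; rewrite normr0.
- by move=> _ [u _ <-].
- exact: dual_norm_ub.
- by move=> _ [u u1 <-]; exact: fM.
Qed.

Let opnormD f g : opnorm (f + g) <= opnorm f + opnorm g.
Proof.
apply: opnorm_le => [|x x1]; first by rewrite addr_ge0 ?opnorm_ge0.
by rewrite (le_trans (ler_normD _ _))// lerD ?le_opnorm1.
Qed.

Let opnormZ (a : K) f : opnorm (a *: f) = `|a| * opnorm f.
Proof.
have leZ b g : opnorm (b *: g) <= `|b| * opnorm g.
  apply: opnorm_le => [|x x1]; first by rewrite mulr_ge0 ?opnorm_ge0.
  by rewrite normrM ler_wpM2l ?le_opnorm1.
have [->|a0] := eqVneq a 0.
  rewrite scale0r normr0 mul0r; apply/le_anti; rewrite opnorm_ge0 andbT.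
  by apply: opnorm_le => // x _; rewrite normr0.
apply/le_anti; rewrite leZ /= -ler_pdivlMl ?normr_gt0//.
by rewrite -{1}[f](scalerK a0) -normfV leZ.
Qed.

Let opnorm_eq0 f : opnorm f = 0 -> f = 0.
Proof.
move=> f0; apply/val_inj/funext => x /=; apply/eqP; rewrite -normr_le0.
by rewrite (le_trans (le_opnorm f x))// f0 mul0r.
Qed.

HB.instance Definition _ := Lmodule_isNormed.Build K dual
  opnormD opnormZ opnorm_eq0.

End dual_space.

Section projective_tensor_product.
Variables (K : scalarFieldType) (E F : normedModType K).

(* A finite sequence s of pairs stands for the element sum x (x) y, (x, y) in s,
   of the algebraic tensor product of E and F.  The latter is taken as a space
   of linear functionals on the space of all bilinear forms on E x F, with
   (x (x) y)(B) = B x y. *)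
Definition tensor_eq (s s' : seq (E * F)) :=
  forall B : {bilinear E -> F -> K^o},
    \sum_(p <- s) B p.1 p.2 = \sum_(p <- s') B p.1 p.2.

(* The set of costs whose infimum is the projective norm of the tensor s. *)
Definition projective_costs (s : seq (E * F)) : set K :=
  [set \sum_(p <- s') `|p.1| * `|p.2| | s' in [set s' | tensor_eq s' s]].

(* X, with the map (x, y) |-> x (x) y, is the completion of the algebraic tensor
   product of E and F under the projective norm; this determines X up to a
   unique isometric isomorphism. *)
Record projective_tensor_product (X : completeNormedModType K)
    (tens : {bilinear E -> F -> X}) : Prop := {
  projective_norm : forall s : seq (E * F),
    infimums (projective_costs s) `|\sum_(p <- s) tens p.1 p.2| ;
  tensors_dense :
    dense [set \sum_(p <- s) tens p.1 p.2 | s in [set: seq (E * F)]]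
}.

End projective_tensor_product.

Section dunford_pettis.
Variable K : scalarFieldType.

(* V with the coarsest topology making every element of dual V continuous *)
Definition weak (V : normedModType K) : Type :=
  initial_topology (fun (x : V) => (fun f => f x) : {ptws dual V -> K^o}).

HB.instance Definition _ (V : normedModType K) := Topological.on (weak V).

Definition weakly_cauchy (V : normedModType K) (x : nat -> V) :=
  forall f : dual V, cauchy ((f \o x) @ \oo).

(* Relatively weakly compact image of the unit ball: contained in a closed
   compact set of weak W. *)
Definition weakly_compact_operator (V W : normedModType K)
    (L : {linear V -> W}) :=
  continuous L /\
  precompact ([set L x | x in [set x : V | `|x| <= 1]] : set (weak W)).

Definition completely_continuous (V W : normedModType K)
    (L : {linear V -> W}) :=
  continuous L /\
  forall x : nat -> V, weakly_cauchy x -> cauchy ((L \o x) @ \oo).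

(* The definition uses only the norm of V, so completeness of V is not asked
   for; duals are complete in any case. *)
Definition dunford_pettis (V : normedModType K) :=
  forall (W : completeNormedModType K) (L : {linear V -> W}),
    weakly_compact_operator L -> completely_continuous L.

End dunford_pettis.

(* Main.v *)
Require Import Defs.
From HB Require Import structures.
From mathcomp Require Import all_boot all_order all_algebra complex.
From mathcomp Require Import boolp classical_sets functions cardinality reals.
From mathcomp Require Import topology normedtype.
From mathcomp Require Import ring.

(** The bidual of X = C(K1) (x) C(K2), the projective tensor product, carries a
    bounded linear map S into l_2 that sends some weakly null sequence (z_k) to
    the unit vector basis.  Composed with the inclusion of l_2 into c_0, and
    with an embedding of c_0 into C(K1), it is a weakly compact operator that is
    not completely continuous, so the Dunford-Pettis property fails
    (not_dunford_pettis).

    Each infinite compact Hausdorff space K carries continuous functions f_j with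
    disjoint supports and norm at most 1, together with points t_i such that
    f_j (t_i) is 1 for i = j and 0 otherwise (real_bumps_exist): they span a
    copy of c_0 in C(K).  Let (f_j, t_j) and (g_k, s_k) be such systems on K1
    and K2, and let r_k (j) be the Rademacher sign given by the k-th binary
    digit of j.

    - The vector z_k is the elementary tensor in the bidual of X of the weak*
      sum of the series sum_j r_k (j) f_j, an element of the bidual of C(K1),
      and of g_k.

    - The l-th coordinate of S is the limit in n, along an ultrafilter, of the
      bilinear forms (u, v) |-> E[u (t_j) r_l (j)] v (s_l), where E is the mean
      over j < 2^n.  For each n these coordinates are square-summable over
      l < n by the orthogonality of the signs (bessel, bessel_bidual), hence so
      are their limits (coordinates_sqr_le), and they take the value 1 or 0 at
      z_k according as k = l or not (coordinates_witnesses).  Passing to the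
      limit inside the dual of the bidual is what makes S possible: it need not
      be the bitranspose of an operator defined on X.

    - The sequence (z_k) is weakly null because any sum of N = m^2 distinct
      terms, with arbitrary coefficients of modulus at most 1, has norm at most
      4 m, which is o(N) (norm_rademacher_tens_sum_le, witnesses_weakly_null).
      The projective norm is estimated by writing the sum as an average over
      signs e of elementary tensors q_e (x) (sum_k e_k g_k), where q_e is the
      imaginary part of the Riesz product prod_k (1 + i c e_k r_k) with
      c = 1 / (2 m): all these tensors are bounded by 2, and averaging
      extracts the sum multiplied by c.

    The argument works over any scalar field whose closed balls are compact and
    whose norm satisfies the parallelogram law; the real and the complex
    numbers are two instances. *)

Set Implicit Arguments.
Unset Strict Implicit.
Unset Printing Implicit Defensive.

Import Order.TTheory GRing.Theory Num.Theory.
Import numFieldNormedType.Exports.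

Local Open Scope classical_set_scope.
Local Open Scope ring_scope.

(** * Scalars and limits along ultrafilters *)

Section scalars.
Variable K : scalarFieldType.

(** Completeness of the scalars, in the form that gives every bounded family a
    limit along an ultrafilter.  The functionals on X, on its dual and on its
    bidual that the proof needs are built as such limits, which always exist and
    depend linearly on the family. *)
Definition closed_balls_compact :=
  forall M : K, 0 <= M -> compact [set x : K^o | `|x| <= M].

(** Archimedean property: if x bounded the natural numbers, their supremum minus
    1 would bound them as well. *)
Lemma le_nat_bound (x : K) : 0 <= x -> exists n : nat, x <= n%:R.
Proof.
move=> x0; apply/not_existsP => nx.
pose A : set K := [set n%:R | n in [set: nat]].
have A0 : A !=set0 by exists 0%:R, 0.
have Age0 y : A y -> 0 <= y by case=> n _ <-; exact: ler0n.
have ubA : has_ubound A.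
  exists x => _ [n _ <-]; have /negP := nx n.
  by rewrite -real_ltNge ?ger0_real// => /ltW.
have : supremum 0 A <= supremum 0 A - 1.
  apply: nneg_supremum_le => // _ [n _ <-].
  by rewrite lerBrDr natr1; apply: nneg_supremum_ub => //; exists n.+1.
by rewrite lerDl oppr_ge0 ler10.
Qed.

(** The substitute for complex conjugation in an abstract scalar field; at
    v = 0 the quotient is 0. *)
Lemma phaseP (v : K) : `| `|v| / v | <= 1 /\ `|v| / v * v = `|v|.
Proof.
have [->|v0] := eqVneq v 0; first by rewrite normr0 !mul0r normr0.
by rewrite divfK// normrM normfV normr_id divff// normr_eq0.
Qed.

Lemma norm_cvg_le (V : normedModType K) (I : Type) (F : set_system I)
    (FF : ProperFilter F) (u : I -> V) (l : V) (M : K) :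
  u i @[i --> F] --> l -> (\forall i \near F, `|u i| <= M) -> `|l| <= M.
Proof.
move=> ul uM; apply/ler_addgt0Pr => e e0.
have [i [uiM lui]] : exists i, `|u i| <= M /\ `|l - u i| <= e.
  apply: (@filter_ex _ F); apply: filterI => //.
  by move/cvgrPdist_le : ul => /(_ _ e0).
rewrite -(subrK (u i) l) addrC (le_trans (ler_normD _ _))//.
by rewrite lerD.
Qed.

Lemma cvg_sum (V : normedModType K) (I J : Type) (F : set_system I)
    (FF : Filter F) (r : seq J) (u : J -> I -> V) (l : J -> V) :
  (forall k, u k i @[i --> F] --> l k) ->
  (\sum_(k <- r) u k i) @[i --> F] --> \sum_(k <- r) l k.
Proof.
move=> ul; elim: r => [|k r IHr].
  by rewrite big_nil; under eq_fun do rewrite big_nil; exact: cvg_cst.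
rewrite big_cons; under eq_fun do rewrite big_cons.
exact: cvgD.
Qed.

End scalars.

Section ultrafilter_limits.
Variables (K : scalarFieldType) (I : Type) (U : set_system I).
Hypothesis ballK : closed_balls_compact K.
Hypothesis ultraU : UltraFilter U.

Lemma bounded_ultra_cvg (u : I -> K) (M : K) : 0 <= M ->
  (\forall i \near U, `|u i| <= M) -> exists l : K^o, u i @[i --> U] --> l.
Proof.
move=> M0 uM.
have [l [_ cl]] := @ballK M M0 (u @ U) _ uM.
exists l => A Al; rewrite nbhs_simpl.
have [//|UA] := in_ultra_setVsetC (u @^-1` A) ultraU.
have : ((u : I -> K^o) @ U) (~` A) by [].
by move=> /cl /(_ Al)[x []].
Qed.

Lemma cvg_near_cst_eq (u : I -> K) (l c : K) :
  (u i : K^o) @[i --> U] --> (l : K^o) -> (\forall i \near U, u i = c) -> l = c.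
Proof.
move=> ul uc; apply: (@cvg_unique K^o (@norm_hausdorff K K^o) (u @ U)) => //.
by apply: cvg_near_cst; exact: uc.
Qed.

End ultrafilter_limits.

(** * Bounded functionals *)

Section duals.
Variables (K : scalarFieldType) (V : normedModType K).

Lemma bounded_linear_dual (f : V -> K^o) (M : K) : linear f ->
  (forall x, `|f x| <= M * `|x|) -> exists phi : dual V, forall x, phi x = f x.
Proof.
move=> lf fM.
pose fL : {linear V -> K^o} := HB.pack f (GRing.isLinear.Build K V K^o *:%R f lf).
have cf : continuous f.
  apply: (@bounded_linear_continuous _ _ _ fL); apply/bounded_funP => r.
  exists (`|M| * r) => x xr; apply: (le_trans (fM x)).
  apply: (@le_trans _ _ (`|M| * `|x|)); last by rewrite ler_wpM2l.
  by rewrite -[leLHS]ger0_norm ?normrM ?normr_id// (le_trans _ (fM x)).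
have df : f \in @dual_pred K V by rewrite inE.
by exists (Dual df).
Qed.

Lemma dual_le (phi : dual V) x : `|phi x| <= `|phi| * `|x|.
Proof. exact: le_opnorm. Qed.

Lemma dual_norm_le (phi : dual V) (M : K) : 0 <= M ->
  (forall x, `|phi x| <= M * `|x|) -> `|phi| <= M.
Proof.
move=> M0 pM; apply: opnorm_le => // x x1; apply: (le_trans (pM x)).
by rewrite ler_piMr.
Qed.

End duals.

Lemma bidual_eval (K : scalarFieldType) (V : normedModType K) (x : V) :
  exists2 z : dual (dual V), `|z| <= `|x| & forall phi : dual V, z phi = phi x.
Proof.
have xle (phi : dual V) : `|phi x| <= `|x| * `|phi| by rewrite mulrC dual_le.
have [|z zE] := bounded_linear_dual (f := fun phi : dual V => phi x) _ xle.
  by [].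
by exists z => //; apply: dual_norm_le => // phi; rewrite zE.
Qed.

Section ultra_dual.
Variables (K : scalarFieldType) (U : set_system nat).
Hypothesis ballK : closed_balls_compact K.
Hypothesis ultraU : UltraFilter U.

(** A form of the Banach-Alaoglu theorem sufficient for sequences. *)
Lemma ultra_dual (V : normedModType K) (u : nat -> dual V) (M : K) : 0 <= M ->
  (forall n, `|u n| <= M) ->
  exists phi : dual V, forall x, u n x @[n --> U] --> (phi x : K^o).
Proof.
move=> M0 uM.
have unM n x : `|u n x| <= M * `|x|.
  by rewrite (le_trans (dual_le _ _))// ler_wpM2r.
have /choice[f fP] (x : V) : exists l : K^o, u n x @[n --> U] --> l.
  by apply: (bounded_ultra_cvg ballK ultraU (M := M * `|x|));
    [rewrite mulr_ge0 | exact: nearW].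
have lf : linear f.
  move=> a x y; apply: (@cvg_unique K^o (@norm_hausdorff K K^o) _ _ _ _ (fP _)).
  rewrite (_ : (fun n => _) = (fun n => a *: (u n x : K^o) + u n y)).
    by apply: cvgD => //; apply: cvgZl_tmp.
  by apply/funext => n; rewrite dual_linear.
have fM x : `|f x| <= M * `|x|.
  by apply: (@norm_cvg_le K K^o nat U _ _ _ _ (fP x)); near=> n.
have [phi phiE] := bounded_linear_dual lf fM.
by exists phi => x; rewrite phiE.
Unshelve. all: by end_near. Qed.

End ultra_dual.

(** * Functionals on a projective tensor product *)

Lemma near_inv_nat_le (K : scalarFieldType) (D e : K) : 0 <= D -> 0 < e ->
  \forall n \near \oo, D / n.+1%:R <= e.
Proof.
move=> D0 e0; have [N DN] := le_nat_bound (divr_ge0 D0 (ltW e0)).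
exists N => // n /= Nn; rewrite ler_pdivrMr ?ltr0n// mulrC -ler_pdivrMr//.
by rewrite (le_trans DN)// ler_nat (leq_trans Nn).
Qed.

Section projective_functionals.
Variables (K : scalarFieldType) (E F : normedModType K).
Variables (X : completeNormedModType K) (tens : {bilinear E -> F -> X}).
Hypothesis projX : projective_tensor_product tens.

Local Notation tsum s := (\sum_(p <- s) tens p.1 p.2).

Lemma norm_tens_le x y : `|tens x y| <= `|x| * `|y|.
Proof.
have [+ _] := projective_norm projX [:: (x, y)].
by rewrite big_seq1; apply; exists [:: (x, y)] => //; rewrite big_seq1.
Qed.

Lemma tsum_approx x (e : K) : 0 < e -> exists s, `|x - tsum s| <= e.
Proof.
move=> e0.
have ne : ball x e !=set0 by exists x; exact: ballxx.
have [y [xy [s _ sy]]] := tensors_dense projX ne (ball_open x e).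
by exists s; rewrite sy ltW//; move: xy; rewrite -ball_normE.
Qed.

(** The norm of a tensor is only an infimum of costs, but a bilinear form does
    not distinguish the representations over which it is taken. *)
Lemma bilinear_tsum_le (b : {bilinear E -> F -> K^o}) (C : K) s : 0 <= C ->
  (forall x y, `|b x y| <= C * (`|x| * `|y|)) ->
  `|\sum_(p <- s) b p.1 p.2| <= C * `|tsum s|.
Proof.
move=> C0 bC; have bs s' : tensor_eq s' s ->
    `|\sum_(p <- s) b p.1 p.2| <= C * \sum_(p <- s') `|p.1| * `|p.2|.
  move=> <-; rewrite mulr_sumr (le_trans (ler_norm_sum _ _ _))//.
  by apply: ler_sum => p _.
have [C_eq0|C_neq0] := eqVneq C 0.
  by rewrite C_eq0 mul0r (le_trans (bs s _))// C_eq0 mul0r.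
have {}C0 : 0 < C by rewrite lt_def C_neq0.
rewrite -ler_pdivrMl//; have [_] := projective_norm projX s; apply.
by move=> _ [s' ss' <-]; rewrite ler_pdivrMl// bs.
Qed.

(** By density it suffices to estimate phi on finite tensors, where it is the
    bilinear form (x, y) |-> phi (tens x y). *)
Lemma dual_norm_le_tens (phi : dual X) (C : K) : 0 <= C ->
  (forall x y, `|phi (tens x y)| <= C * (`|x| * `|y|)) -> `|phi| <= C.
Proof.
move=> C0 phiC; apply: dual_norm_le => // x.
have bP : bilinear_for *:%R *:%R (fun x y => phi (tens x y) : K^o).
  split=> [u' a u v|u a v w].
    by rewrite linearDl linearZl_LR dual_linear.
  by rewrite linearPr dual_linear.
pose b : {bilinear E -> F -> K^o} := HB.pack (fun x y => phi (tens x y) : K^o)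
  (bilinear_isBilinear.Build K E F K^o *:%R *:%R _ bP).
have phi_tsum s : `|phi (tsum s)| <= C * `|tsum s|.
  by rewrite linear_sum; exact: (@bilinear_tsum_le b).
apply/ler_addgt0Pr => e e0.
have D0 : 0 < `|phi| + C + 1 by rewrite ltr_wpDl// addr_ge0.
have [s xs] := tsum_approx x (divr_gt0 e0 D0).
rewrite -{1}(subrK (tsum s) x) linearD (le_trans (ler_normD _ _))//.
have sx : `|tsum s| <= `|x| + `|x - tsum s|.
  by rewrite -{1}(subKr x (tsum s)) (le_trans (ler_normB _ _)).
have {sx} := le_trans (phi_tsum s) (ler_wpM2l C0 sx).
rewrite mulrDr => /(lerD (dual_le phi (x - tsum s))) /le_trans; apply.
rewrite addrCA lerD2l -mulrDl.
rewrite ler_pdivlMr// mulrC in xs; apply: le_trans xs.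
by rewrite ler_wpM2r// lerDl.
Qed.

Hypothesis ballK : closed_balls_compact K.

(** Extension by density: x is approximated by finite tensors S (x, n) at
    distance 1 / n.+1, and phi x is the limit of the values of b along an
    ultrafilter.  Two approximations of the same vector have close values by
    bilinear_tsum_le, whence linearity. *)
Lemma tens_extend (b : {bilinear E -> F -> K^o}) (C : K) : 0 <= C ->
  (forall x y, `|b x y| <= C * (`|x| * `|y|)) ->
  exists phi : dual X, forall x y, phi (tens x y) = b x y.
Proof.
move=> C0 bC; pose bs (s : seq (E * F)) : K := \sum_(p <- s) b p.1 p.2.
have [U [ultraU UN]] := ultraFilterLemma (eventually_filter).
pose sc a (s : seq (E * F)) := [seq (a *: p.1, p.2) | p <- s].
have bs_sc a s : bs (sc a s) = a * bs s.
  rewrite /bs big_map mulr_sumr; apply: eq_bigr => p _ /=.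
  by rewrite linearZl_LR.
have ts_sc a s : tsum (sc a s) = a *: tsum s.
  rewrite big_map scaler_sumr; apply: eq_bigr => p _ /=.
  by rewrite linearZl_LR.
have bs_cat s s' : bs (s ++ s') = bs s + bs s' by rewrite /bs big_cat.
have bs_le s : `|bs s| <= C * `|tsum s| by exact: bilinear_tsum_le.
have /choice[S SP] (xn : X * nat) :
    exists s, `|xn.1 - tsum s| <= xn.2.+1%:R^-1.
  by apply: tsum_approx; rewrite invr_gt0 ltr0n.
have S_le x n : `|tsum (S (x, n))| <= `|x| + n.+1%:R^-1.
  rewrite -(subKr x (tsum _)) (le_trans (ler_normB _ _))// lerD2l.
  exact: SP (x, n).
have inv_nat1 n : (n.+1%:R^-1 : K) <= 1.
  by rewrite invf_le1 ?ltr0n// ler1n.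
have /choice[f fP] (x : X) : exists l : K^o, bs (S (x, n)) @[n --> U] --> l.
  apply: (bounded_ultra_cvg ballK ultraU (M := C * (`|x| + 1))).
    by rewrite mulr_ge0// addr_ge0.
  apply: nearW => n; rewrite (le_trans (bs_le _))// ler_wpM2l//.
  by rewrite (le_trans (S_le _ _))// lerD2l.
(* Errors of order 1 / n.+1 vanish in the limit, since U refines \oo. *)
have small (u : nat -> K^o) (l D : K) : 0 <= D -> u n @[n --> U] --> (l : K^o) ->
    (forall n, `|u n| <= D / n.+1%:R) -> l = 0.
  move=> D0 ul uD; apply/eqP; rewrite -normr_le0; apply/ler_addgt0Pr => e e0.
  rewrite add0r; apply: (@norm_cvg_le K K^o nat U _ _ _ _ ul).
  apply: UN; have := near_inv_nat_le D0 e0.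
  by apply: filterS => n; exact: le_trans.
have lf : linear (f : X -> K^o).
  move=> a x y; apply/eqP; rewrite -subr_eq0; apply/eqP.
  apply: (small (fun n => bs (S (a *: x + y, n)) -
      (a *: (bs (S (x, n)) : K^o) + bs (S (y, n)))) _ (C * (1 + (`|a| + 1)))).
  - by rewrite mulr_ge0// !addr_ge0.
  - by apply: cvgB => //; apply: cvgD => //; exact: cvgZl_tmp.
  (* The defect of linearity at stage n is the value of b on a single tensor s,
     which is close to 0 in X. *)
  move=> n; pose s := S (a *: x + y, n) ++
    sc (-1) (sc a (S (x, n)) ++ S (y, n)).
  have -> : bs (S (a *: x + y, n)) - (a *: (bs (S (x, n)) : K^o) + bs (S (y, n)))
      = bs s.
    by rewrite bs_cat bs_sc bs_cat bs_sc mulN1r.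
  rewrite (le_trans (bs_le s))// -mulrA ler_wpM2l//.
  have -> : tsum s = - (a *: x + y - tsum (S (a *: x + y, n))) +
      (a *: (x - tsum (S (x, n))) + (y - tsum (S (y, n)))).
    rewrite big_cat ts_sc big_cat ts_sc/= scaleN1r scalerBr.
    set A := _ *: x; set B := a *: _; rewrite opprB (addrACA A).
    by rewrite [RHS]addrA subrK opprD.
  rewrite (le_trans (ler_normD _ _))// normrN mulrDl lerD ?mul1r//.
    exact: SP (a *: x + y, n).
  rewrite (le_trans (ler_normD _ _))// mulrDl lerD ?mul1r//.
    by rewrite normrZ ler_wpM2l//; exact: SP (x, n).
  exact: SP (y, n).
have fC x : `|f x| <= C * `|x|.
  apply/ler_addgt0Pr => e e0; apply: (@norm_cvg_le K K^o nat U _ _ _ _ (fP x)).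
  apply: UN; have := near_inv_nat_le C0 e0; apply: filterS => n Ce.
  by rewrite (le_trans (bs_le _))// (le_trans (ler_wpM2l C0 (S_le _ _)))// mulrDr lerD2l.
have [phi phiE] := bounded_linear_dual lf fC.
exists phi => x y; rewrite phiE; apply/eqP; rewrite -subr_eq0; apply/eqP.
apply: (small (fun n => bs (S (tens x y, n)) - b x y) _ C) => //.
  by apply: cvgB => //; exact: cvg_cst.
move=> n; pose s := S (tens x y, n) ++ [:: (- x, y)].
have -> : bs (S (tens x y, n)) - b x y = bs s.
  by rewrite bs_cat /bs big_seq1 linearNl.
rewrite (le_trans (bs_le s))// ler_wpM2l// big_cat big_seq1 linearNl -normrN.
by rewrite opprB; exact: SP (tens x y, n).
Qed.

End projective_functionals.

Lemma dual_sumE (K : scalarFieldType) (V : normedModType K) I (r : seq I)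
    (P : pred I) (phi : I -> dual V) x :
  (\sum_(i <- r | P i) phi i) x = \sum_(i <- r | P i) phi i x.
Proof. by elim/big_rec2 : _ => // i y z _ <-. Qed.

Lemma dualZE (K : scalarFieldType) (V : normedModType K) a (phi : dual V) x :
  (a *: phi) x = a * phi x.
Proof. by []. Qed.

(** * Copies of c_0 in spaces of continuous functions *)

Section bumps.
Variables (K : scalarFieldType) (T : topologicalType) (cT : compact [set: T]).

Lemma contfun_le (f : contfun K cT) x : `|f x| <= `|f|.
Proof. exact: le_supnorm. Qed.

(** The data that the argument takes from an infinite compact space: an
    isometric copy of c_0 spanned by the f_j, with the evaluations at the
    points t_i as biorthogonal functionals. *)
Definition bumps (f : nat -> contfun K cT) (t : nat -> T) :=
  (forall i j, f j (t i) = (i == j)%:R) /\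
  (forall N x, \sum_(j < N) `|f j x| <= 1).

Lemma contfun_sumE I (r : seq I) (P : pred I) (f : I -> contfun K cT) x :
  (\sum_(i <- r | P i) f i) x = \sum_(i <- r | P i) f i x.
Proof. by elim/big_rec2 : _ => // i y z _ <-. Qed.

Lemma contfunZE a (f : contfun K cT) x : (a *: f) x = a * f x.
Proof. by []. Qed.

(** The upper half of the isometry of c_0 with the span of the f_j; the lower
    half comes from the evaluations at the t_j. *)
Lemma norm_bump_sum_le f t (a : nat -> K) (C : K) (N : nat) : bumps f t -> 0 <= C ->
  (forall j, `|a j| <= C) -> `|\sum_(j < N) a j *: f j| <= C.
Proof.
move=> [_ f1] C0 aC; apply: supnorm_le => // x.
rewrite contfun_sumE (le_trans (ler_norm_sum _ _ _))//.
apply: (@le_trans _ _ (C * \sum_(j < N) `|f j x|)); last by rewrite ler_piMr.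
by rewrite mulr_sumr ler_sum// => j _; rewrite contfunZE normrM ler_wpM2r.
Qed.

Lemma bump_sum_eval f t (a : nat -> K) (N i : nat) : bumps f t -> (i < N)%N ->
  (\sum_(j < N) a j *: f j) (t i) = a i.
Proof.
move=> [ft _] iN; rewrite contfun_sumE.
under eq_bigr => j _ do rewrite contfunZE ft.
rewrite (bigD1 (Ordinal iN))//= eqxx mulr1 big1 ?addr0// => j ji.
have /negPf-> : i != j by apply: contra ji => /eqP ij; apply/eqP/val_inj.
by rewrite mulr0.
Qed.

End bumps.

(** * Rademacher signs and the Bessel inequality *)

Section rademacher_functions.
Variable K : scalarFieldType.

(** The sign given by the k-th binary digit of j.  The restrictions to j < 2 ^ n
    of the functions of index k < n are the coordinates of the cube
    {-1, 1} ^ n. *)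
Definition rademacher (k j : nat) : K := (-1) ^+ (j %/ 2 ^ k).

Lemma normr_rademacher k j : `|rademacher k j| = 1.
Proof. by rewrite normrX normrN1 expr1n. Qed.

Lemma rademacher_sqr k j : rademacher k j * rademacher k j = 1.
Proof. by rewrite -expr2 sqrr_sign. Qed.

Lemma rademacher_real k j : rademacher k j \is Num.real.
Proof. by rewrite rpredX// rpredN rpred1. Qed.

Lemma rademacher_shift k n j : (k < n)%N -> rademacher k (2 ^ n + j) = rademacher k j.
Proof.
move=> kn; have -> : (2 ^ n = 2 ^ (n - k.+1) * 2 * 2 ^ k)%N.
  by rewrite -mulnA -expnS -expnD subnK.
by rewrite /rademacher divnMDl ?expn_gt0// exprD exprM sqrr_sign mul1r.
Qed.

Lemma rademacher_low n j : (j < 2 ^ n)%N -> rademacher n j = 1.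
Proof. by move=> jn; rewrite /rademacher divn_small. Qed.

Lemma rademacher_high n j : (j < 2 ^ n)%N -> rademacher n (2 ^ n + j) = -1.
Proof.
by move=> jn; rewrite /rademacher -{1}[(2 ^ n)%N]mul1n divnMDl ?expn_gt0// divn_small.
Qed.

(** This law makes the Rademacher functions orthogonal; an abstract scalar field
    has no conjugation that would define an inner product. *)
Definition parallelogram_law := forall a b : K,
  `|a + b| ^+ 2 + `|a - b| ^+ 2 = 2 * (`|a| ^+ 2 + `|b| ^+ 2).

(** Orthogonality of the signs, by induction on n: replacing j < 2 ^ n by
    2 ^ n + j changes only the sign r_n, so that the parallelogram law adds the
    term |c_n|^2. *)
Lemma sum_normr2_rademacher (c : nat -> K) n : parallelogram_law ->
  \sum_(j < 2 ^ n) `|\sum_(l < n) c l * rademacher l j| ^+ 2 =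
  2 ^+ n * \sum_(l < n) `|c l| ^+ 2.
Proof.
move=> par; elim: n => [|n IHn].
  by rewrite big_ord_recl !big_ord0 normr0 expr0n mulr0 addr0.
rewrite expnS mul2n -addnn big_split_ord/= -big_split/=.
rewrite big_ord_recr/= exprS -mulrA mulrDr -IHn mulrDr mulr_sumr.
rewrite (_ : 2 * (2 ^+ n * `|c n| ^+ 2) = \sum_(j < 2 ^ n) 2 * `|c n| ^+ 2); last first.
  by rewrite sumr_const card_ord mulrCA -[RHS]mulr_natl natrX.
rewrite -big_split/=; apply: eq_bigr => j _.
rewrite !big_ord_recr/= rademacher_low// rademacher_high// mulr1 mulrN1.
under [X in `|X - _|]eq_bigr => l _ do rewrite rademacher_shift//.
by rewrite par mulrDr.
Qed.

End rademacher_functions.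

Section bessel.
Variables (K : scalarFieldType) (par : parallelogram_law K).
Variables (T1 T2 : topologicalType).
Variables (cT1 : compact [set: T1]) (cT2 : compact [set: T2]).
Variables (X : completeNormedModType K).
Variables (tens : {bilinear contfun K cT1 -> contfun K cT2 -> X}).
Hypothesis projX : projective_tensor_product tens.
Variables (t : nat -> T1) (s : nat -> T2) (D : nat -> nat -> dual X).
Hypothesis DE : forall j l f g, D j l (tens f g) = f (t j) * g (s l).

(** The form (u, v) |-> v (s l) * E[u (t j) r_l (j)], with j uniform on
    {0, .., 2 ^ n - 1}. *)
Definition rademacher_form n l : dual X :=
  (2 ^+ n)^-1 *: \sum_(j < 2 ^ n) rademacher K l j *: D j l.

Lemma rademacher_formE n l f g : rademacher_form n l (tens f g) =
  (2 ^+ n)^-1 * \sum_(j < 2 ^ n) rademacher K l j * (f (t j) * g (s l)).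
Proof.
rewrite dualZE dual_sumE; congr (_ * _).
by apply: eq_bigr => j _; rewrite dualZE DE.
Qed.

Lemma norm_rademacher_form n l : `|rademacher_form n l| <= 1.
Proof.
apply: (dual_norm_le_tens projX) => // f g; rewrite mul1r.
rewrite rademacher_formE normrM normfV normrX normr_nat ler_pdivrMl ?exprn_gt0//.
rewrite (le_trans (ler_norm_sum _ _ _))//.
apply: (@le_trans _ _ (\sum_(j < 2 ^ n) `|f| * `|g|)); last first.
  by rewrite sumr_const card_ord -natrX mulr_natl.
apply: ler_sum => j _.
rewrite normrM normr_rademacher mul1r normrM.
by rewrite ler_pM// contfun_le.
Qed.

(** For l < n the forms rademacher_form n l are dominated by an orthonormal
    system: E|sum_l a_l v (s l) r_l| is at most the l_2 norm of
    (a_l v (s l)).  The parameter lam avoids the square root of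
    sum_l |a_l|^2, which an abstract scalar field need not have: the optimal
    lam is that square root. *)
Lemma bessel (a : nat -> K) (lam : K) n : 0 < lam ->
  2 * lam * `|\sum_(l < n) a l *: rademacher_form n l| <=
  lam ^+ 2 + \sum_(l < n) `|a l| ^+ 2.
Proof.
move=> lam0; rewrite -ler_pdivlMl ?mulr_gt0//.
set q := \sum_(l < n) `|a l| ^+ 2.
have q0 : 0 <= q by apply: sumr_ge0 => l _; rewrite exprn_ge0.
apply: (dual_norm_le_tens projX) => [|f g].
  by rewrite mulr_ge0// ?invr_ge0 ?mulr_ge0// ?addr_ge0// ?exprn_ge0// ltW.
pose S j := \sum_(l < n) (a l * g (s l)) * rademacher K l j.
have -> : (\sum_(l < n) a l *: rademacher_form n l) (tens f g) =
    (2 ^+ n)^-1 * \sum_(j < 2 ^ n) f (t j) * S j.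
  rewrite dual_sumE mulr_sumr.
  under eq_bigr => l _ do rewrite dualZE rademacher_formE mulrCA mulr_sumr mulr_sumr.
  rewrite exchange_big/=; apply: eq_bigr => j _.
  by rewrite mulrA mulr_sumr; apply: eq_bigr => l _; ring.
have [g0|g0] := eqVneq g 0.
  rewrite [X in `|_ * X|]big1 ?mulr0 ?normr0 ?g0 ?normr0 ?mulr0// => j _.
  by rewrite [S j]big1 ?mulr0// => l _; rewrite g0 mulr0 mul0r.
have {}g0 : 0 < `|g| by rewrite normr_gt0.
have S_le : \sum_(j < 2 ^ n) `|S j| ^+ 2 <= 2 ^+ n * (q * `|g| ^+ 2).
  rewrite [leLHS](sum_normr2_rademacher (fun l => a l * g (s l)) n par).
  rewrite ler_wpM2l ?exprn_ge0// mulr_suml ler_sum// => l _.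
  by rewrite normrM exprMn ler_wpM2l ?exprn_ge0// lerXn2r ?nnegrE ?contfun_le.
rewrite normrM normfV normrX normr_nat ler_pdivrMl ?exprn_gt0//.
rewrite -[X in _ <= _ * X]mulrA [leRHS]mulrCA ler_pdivlMl ?mulr_gt0//.
rewrite -(ler_pM2r g0); set N : K := 2 ^+ n.
pose Z := \sum_(j < 2 ^ n) `|S j|.
have Z_le : 2 * (lam * `|g|) * Z <= N * ((lam ^+ 2 + q) * `|g| ^+ 2).
  rewrite (mulrDl (lam ^+ 2)) mulrDr -exprMn.
  apply: le_trans (lerD (lexx _) S_le).
  rewrite -[N * _](_ : \sum_(j < 2 ^ n) (lam * `|g|) ^+ 2 = _); last first.
    by rewrite sumr_const card_ord -[LHS]mulr_natl natrX.
  rewrite -big_split mulr_sumr ler_sum// => j _ /=.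
  rewrite -subr_ge0 (_ : _ - _ = (lam * `|g| - `|S j|) ^+ 2); last by ring.
  rewrite real_exprn_even_ge0// realB ?normr_real// realM ?normr_real//.
  exact: gtr0_real.
have fS_le : `|\sum_(j < 2 ^ n) f (t j) * S j| <= `|f| * Z.
  rewrite mulr_sumr (le_trans (ler_norm_sum _ _ _))// ler_sum// => j _.
  by rewrite normrM ler_wpM2r// contfun_le.
apply: (@le_trans _ _ (2 * lam * (`|f| * Z) * `|g|)).
  by rewrite ler_wpM2r// ler_wpM2l// mulr_ge0// ltW.
rewrite [leLHS](_ : _ = `|f| * (2 * (lam * `|g|) * Z)); last by ring.
rewrite [leRHS](_ : _ = `|f| * (N * ((lam ^+ 2 + q) * `|g| ^+ 2))); last by ring.
by rewrite ler_wpM2l.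
Qed.

(** Dual form of the Bessel inequality: with a_l = |w_l|^2 / w_l, where
    w_l = z (rademacher_form n l), the sum q of the |w_l|^2 is the value of z
    at a combination to which bessel applies, and lam = M turns the bound
    q <= (M^2 + q) / 2 into q <= M^2. *)
Lemma bessel_bidual (z : dual (dual X)) (M : K) n : 0 < M -> `|z| <= M ->
  \sum_(l < n) `|z (rademacher_form n l)| ^+ 2 <= M ^+ 2.
Proof.
move=> M0 zM; set q := \sum_(l < n) _.
pose a l : K := `|z (rademacher_form n l)| ^+ 2 / z (rademacher_form n l).
have norma l : `|a l| = `|z (rademacher_form n l)|.
  rewrite normrM normfV normrX normr_id.
  have [->|zl0] := eqVneq (z (rademacher_form n l)) 0.
    by rewrite normr0 invr0 mulr0.
  by rewrite expr2 mulfK// normr_eq0.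
have zq : z (\sum_(l < n) a l *: rademacher_form n l) = q.
  rewrite linear_sum; apply: eq_bigr => l _; rewrite linearZ/=.
  have [zl0|zl0] := eqVneq (z (rademacher_form n l)) 0.
    by rewrite /a zl0 normr0 expr0n invr0 mulr0 scale0r.
  by rewrite -[LHS]/(a l * z (rademacher_form n l)) divfK.
have q0 : 0 <= q by apply: sumr_ge0 => l _; rewrite exprn_ge0.
have := bessel a n M0; under [X in _ <= _ + X]eq_bigr => l _ do rewrite norma.
rewrite -/q => Mq.
have qle : q <= M * `|\sum_(l < n) a l *: rademacher_form n l|.
  by rewrite -[leLHS]ger0_norm// -zq (le_trans (dual_le _ _))// ler_wpM2r.
have : 2 * q <= M ^+ 2 + q.
  by apply: le_trans Mq; rewrite -mulrA ler_wpM2l.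
by rewrite mulr_natl mulr2n lerD2r.
Qed.

End bessel.

(** * A map into l_2 and the vectors it sends to the unit basis *)

Section coordinates.
Variables (K : scalarFieldType) (par : parallelogram_law K).
Hypothesis ballK : closed_balls_compact K.
Variables (U : set_system nat) (ultraU : UltraFilter U).
Hypothesis UN : (\oo : set_system nat) `<=` U.
Variables (T1 T2 : topologicalType).
Variables (cT1 : compact [set: T1]) (cT2 : compact [set: T2]).
Variables (X : completeNormedModType K).
Variables (tens : {bilinear contfun K cT1 -> contfun K cT2 -> X}).
Hypothesis projX : projective_tensor_product tens.
Variables (f : nat -> contfun K cT1) (t : nat -> T1).
Variables (g : nat -> contfun K cT2) (s : nat -> T2).
Hypothesis ft : bumps f t.
Hypothesis gs : bumps g s.

(** As J grows these vectors of X have a weak* limit in the bidual, the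
    elementary tensor of g_k with the element sum_j r_k (j) f_j of the bidual
    of C(T1). *)
Definition rademacher_tens J k : X := tens (\sum_(j < J) rademacher K k j *: f j) (g k).

Lemma point_functionals :
  exists D : nat -> nat -> dual X, forall j l u v, D j l (tens u v) = u (t j) * v (s l).
Proof.
have bP x y : bilinear_for *:%R *:%R
    (fun (u : contfun K cT1) (v : contfun K cT2) => u x * v y : K^o).
  split=> [v a u u'|u a v v']; first by rewrite [LHS]mulrDl -mulrA.
  by rewrite [LHS]mulrDr mulrCA.
pose b x y : {bilinear contfun K cT1 -> contfun K cT2 -> K^o} :=
  HB.pack (fun (u : contfun K cT1) (v : contfun K cT2) => u x * v y : K^o)
  (bilinear_isBilinear.Build K (contfun K cT1) (contfun K cT2) K^o *:%R *:%R _ (bP x y)).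
have /choice[D DE] (jl : nat * nat) : exists phi : dual X,
    forall u v, phi (tens u v) = u (t jl.1) * v (s jl.2).
  have [|u v|phi phiE] := @tens_extend _ _ _ _ _ projX ballK (b (t jl.1) (s jl.2)) 1.
  - exact: ler01.
  - by rewrite mul1r /= normrM ler_pM// contfun_le.
  - by exists phi.
by exists (fun j l => D (j, l)) => j l; exact: (DE (j, l)).
Qed.

Variable D : nat -> nat -> dual X.
Hypothesis DE : forall j l u v, D j l (tens u v) = u (t j) * v (s l).

(** For fixed n the rademacher_form n l with l < n carry a map of the bidual
    into an n-dimensional Hilbert space; the limit over n glues these maps into
    a single one with values in l_2. *)
Lemma coordinates_exist : exists Phi : nat -> dual (dual (dual X)),
  forall l (z : dual (dual X)), z (rademacher_form D n l) @[n --> U] --> (Phi l z : K^o).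
Proof.
suff /choice[Phi] : forall l, exists Phi : dual (dual (dual X)),
    forall z : dual (dual X), z (rademacher_form D n l) @[n --> U] --> (Phi z : K^o).
  by exists Phi.
move=> l.
have /choice[e eP] n : exists e : dual (dual (dual X)),
    `|e| <= 1 /\ forall z : dual (dual X), e z = z (rademacher_form D n l).
  have [e e1 eE] := bidual_eval (rademacher_form D n l); exists e; split=> //.
  by rewrite (le_trans e1)// (norm_rademacher_form projX DE).
have [|Phi PhiP] := ultra_dual ballK ultraU ler01 (u := e).
  by move=> n; case: (eP n).
exists Phi => z; have := PhiP z.
by under eq_fun do rewrite (eP _).2.
Qed.

Lemma norm_rademacher_tens_le J k : `|rademacher_tens J k| <= 1.
Proof.
rewrite (le_trans (norm_tens_le projX _ _))// -[leRHS]mulr1 ler_pM//.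
  apply: (norm_bump_sum_le (a := rademacher K k) _ ft) => // j.
  by rewrite normr_rademacher.
rewrite -[g k]scale1r -[_ *: _](_ : \sum_(j < k.+1) (j == k :> nat)%:R *: g j = _).
  apply: (norm_bump_sum_le (a := fun j => (j == k)%:R) _ gs) => // j.
  by case: eqP; rewrite ?normr1 ?normr0.
rewrite big_ord_recr/= eqxx big1 ?add0r// => j _.
by rewrite ltn_eqF ?scale0r.
Qed.

Lemma witnesses_exist : exists z : nat -> dual (dual X),
  forall k (phi : dual X), phi (rademacher_tens J k) @[J --> U] --> (z k phi : K^o).
Proof.
suff /choice[z] : forall k, exists z : dual (dual X),
    forall phi : dual X, phi (rademacher_tens J k) @[J --> U] --> (z phi : K^o).
  by exists z.
move=> k.
have /choice[e eP] J : exists e : dual (dual X),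
    `|e| <= 1 /\ forall phi : dual X, e phi = phi (rademacher_tens J k).
  have [e e1 eE] := bidual_eval (rademacher_tens J k); exists e; split=> //.
  by rewrite (le_trans e1)// norm_rademacher_tens_le.
have [|z zP] := ultra_dual ballK ultraU ler01 (u := e).
  by move=> n; case: (eP n).
exists z => phi; have := zP phi.
by under eq_fun do rewrite (eP _).2.
Qed.

Variable Phi : nat -> dual (dual (dual X)).
Hypothesis PhiP : forall l (z : dual (dual X)),
  z (rademacher_form D n l) @[n --> U] --> (Phi l z : K^o).
Variable z : nat -> dual (dual X).
Hypothesis zP : forall k (phi : dual X),
  phi (rademacher_tens J k) @[J --> U] --> (z k phi : K^o).

(** Only the terms l < m count, and n >= m holds for U-almost all n, so that
    bessel_bidual passes to the limit. *)
Lemma coordinates_sqr_le (w : dual (dual X)) (M : K) m : 0 < M -> `|w| <= M ->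
  \sum_(l < m) `|Phi l w| ^+ 2 <= M ^+ 2.
Proof.
move=> M0 wM.
have cv : (\sum_(l < m) `|w (rademacher_form D n l)| ^+ 2 : K^o) @[n --> U] -->
    (\sum_(l < m) `|Phi l w| ^+ 2 : K^o).
  apply: (@cvg_sum K K^o nat 'I_m U _ _
    (fun l n => `|w (rademacher_form D n l)| ^+ 2) (fun l => `|Phi l w| ^+ 2)) => l.
  rewrite -[X in _ --> X]/(`|Phi l w| * `|Phi l w|).
  by apply: cvgM; apply: cvg_norm; exact: PhiP.
rewrite -[leLHS]ger0_norm; last by apply: sumr_ge0 => l _; rewrite exprn_ge0.
apply: (@norm_cvg_le K K^o nat U _ _ _ _ cv); apply: UN.
exists m => // n /= mn.
rewrite ger0_norm; last by apply: sumr_ge0 => l _; rewrite exprn_ge0.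
apply: le_trans (bessel_bidual par projX DE n M0 wM).
rewrite -(subnKC mn) big_split_ord/= lerDl; apply: sumr_ge0 => l _.
by rewrite exprn_ge0.
Qed.

(** The two limits are over sequences that are eventually constant: for
    J >= 2 ^ n the value of rademacher_form n l at rademacher_tens J k is
    g_k (s l) E[r_k r_l].  As g_k (s l) is 0 unless k = l, only E[r_k r_k] = 1
    enters. *)
Lemma coordinates_witnesses k l : Phi l (z k) = (k == l)%:R.
Proof.
apply: (cvg_near_cst_eq ultraU (@PhiP l (z k))); apply: nearW => n.
apply: (cvg_near_cst_eq ultraU (@zP k (rademacher_form D n l))); apply: UN.
exists (2 ^ n)%N => // J; rewrite /mkset => nJ.
rewrite /rademacher_tens (rademacher_formE DE) gs.1 eq_sym.
under eq_bigr => j _ do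
  rewrite (bump_sum_eval (rademacher K k) ft (leq_trans (ltn_ord j) nJ)).
have [->|_] := eqVneq k l; last first.
  by rewrite big1 ?mulr0// => j _; rewrite !mulr0.
under eq_bigr => j _ do rewrite mulr1 rademacher_sqr.
by rewrite sumr_const card_ord -natrX mulVf// pnatr_eq0 -lt0n expn_gt0.
Qed.

End coordinates.

(** * Riesz products *)

(** All sign patterns of length n; true stands for the sign -1. *)
Fixpoint signs (n : nat) : seq (seq bool) :=
  if n is n'.+1 then map (cons false) (signs n') ++ map (cons true) (signs n')
  else [:: [::]].

Lemma sum_signsS (V : zmodType) (n : nat) (G : seq bool -> V) :
  \sum_(e <- signs n.+1) G e =
  \sum_(e <- signs n) (G (false :: e) + G (true :: e)).
Proof. by rewrite big_cat !big_map big_split. Qed.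

Lemma size_signs n : size (signs n) = (2 ^ n)%N.
Proof.
by elim: n => //= n IHn; rewrite size_cat !size_map IHn addnn -mul2n expnS.
Qed.

Section riesz_products.
Variables (K : numFieldType) (c : K) (rho : nat -> K).

(** The real and imaginary parts of the Riesz product
    prod_k (1 + i c e_k rho_k), for signs e_k, computed without complex
    numbers. *)
Fixpoint riesz (l : seq nat) (e : seq bool) : K * K :=
  if l is k :: l' then
    let pq := riesz l' (behead e) in
    let d := (-1) ^+ head false e * c * rho k in
    (pq.1 - d * pq.2, pq.2 + d * pq.1)
  else (1, 0).

Lemma sum_riesz_re l : \sum_(e <- signs (size l)) (riesz l e).1 = 2 ^+ size l.
Proof.
elim: l => [|k l IHl]; first by rewrite /= big_seq1.
rewrite [size _]/= sum_signsS exprS -IHl mulr_sumr.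
by apply: eq_bigr => e _ /=; rewrite expr0 expr1; ring.
Qed.

Variables (V : lmodType K) (y : nat -> V).

Fixpoint sign_sum (l : seq nat) (e : seq bool) : V :=
  if l is k :: l' then sign_sum l' (behead e) + (-1) ^+ head false e *: y k
  else 0.

(** In the mean over the signs e, the imaginary part q_e of the Riesz product has
    correlation c rho_k with the sign e_k.  When the rho_k are functions of an
    index, this says that sum_k (c rho_k) (x) y_k is the mean of the elementary
    tensors q_e (x) (sum_k e_k y_k). *)
Lemma sum_riesz_im l :
  \sum_(e <- signs (size l)) (riesz l e).2 *: sign_sum l e =
  (2 ^+ size l * c) *: \sum_(k <- l) rho k *: y k.
Proof.
elim: l => [|k l IHl]; first by rewrite /= big_seq1 big_nil !scaler0.
rewrite [size _]/= sum_signsS big_cons scalerDr.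
have -> : (2 ^+ (size l).+1 * c) *: \sum_(k0 <- l) rho k0 *: y k0 =
    2 *: \sum_(e <- signs (size l)) (riesz l e).2 *: sign_sum l e.
  by rewrite IHl scalerA mulrA -exprS.
have -> : (2 ^+ (size l).+1 * c) *: (rho k *: y k) =
    \sum_(e <- signs (size l)) (2 * (c * rho k) * (riesz l e).1) *: y k.
  by rewrite -scaler_suml -mulr_sumr sum_riesz_re scalerA exprS; congr (_ *: _); ring.
rewrite scaler_sumr -big_split/=; apply: eq_bigr => e _ /=.
rewrite expr0 expr1; set p := (riesz l e).1; set q := (riesz l e).2.
set Y := sign_sum l e; rewrite scale1r scaleN1r mulN1r mul1r mulNr.
rewrite !scalerDr scalerN addrACA -scalerDl -scalerBl addrC scalerA.
by congr (_ *: _ + _ *: _); ring.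
Qed.

Hypothesis c_real : c \is Num.real.
Hypothesis rho_real : forall k, rho k \is Num.real.
Hypothesis rho_sqr : forall k, rho k * rho k = 1.

Lemma riesz_real l e : (riesz l e).1 \is Num.real /\ (riesz l e).2 \is Num.real.
Proof.
elim: l e => [|k l IHl] e /=; first by rewrite real0 real1.
have [p q] := IHl (behead e).
have d : (-1) ^+ head false e * c * rho k \is Num.real.
  by rewrite !rpredM// rpredX// rpredN rpred1.
by split; [apply: rpredB | apply: rpredD] => //; apply: rpredM.
Qed.

(** The squared modulus of the product: each factor has modulus
    sqrt (1 + c^2), as c e_k rho_k is real of square c^2. *)
Lemma riesz_sqr l e :
  (riesz l e).1 ^+ 2 + (riesz l e).2 ^+ 2 = (1 + c ^+ 2) ^+ size l.
Proof.
elim: l e => [|k l IHl] e /=; first by rewrite expr1n expr0n addr0.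
rewrite [RHS]exprS -(IHl (behead e)); set p := (riesz _ _).1; set q := (riesz _ _).2.
have dd : ((-1) ^+ head false e * c * rho k) ^+ 2 = c ^+ 2.
  by rewrite !exprMn sqrr_sign mul1r [rho k ^+ 2]expr2 rho_sqr mulr1.
rewrite -dd; ring.
Qed.

(** The choice of c: for N = m^2 factors and c = 1 / (2 m), the squared modulus
    (1 + 1 / (4 N)) ^ N is at most 1 / (1 - 1/4) = 4 / 3, whereas c N = m / 2 is
    unbounded. *)
Lemma riesz_im_le l e (m : nat) : (0 < m)%N -> c = (2 * m%:R)^-1 ->
  size l = (m ^ 2)%N -> `|(riesz l e).2| <= 2.
Proof.
move=> m0 cE sl.
have x0 : 0 <= c ^+ 2 by rewrite real_exprn_even_ge0.
have bern (x : K) N : 0 <= x -> (1 + x) ^+ N * (1 - N%:R * x) <= 1.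
  move=> {}x0; elim: N => [|N IHN]; first by rewrite expr0 mul0r subr0 mulr1.
  apply: le_trans IHN; rewrite exprSr -mulrA ler_wpM2l ?exprn_ge0 ?addr_ge0//.
  rewrite -natr1 -subr_ge0 (_ : _ - _ = (N%:R + 1) * x ^+ 2); last by ring.
  by rewrite mulr_ge0 ?exprn_ge0// addr_ge0.
have m0' : (m%:R : K) != 0 by rewrite pnatr_eq0 -lt0n.
have := bern _ (size l) x0; rewrite -(riesz_sqr l e) sl cE.
rewrite (_ : 1 - _ = 3 / 4); last by rewrite natrX; field.
set p := (riesz l e).1; set q := (riesz l e).2.
have [p_real q_real] := riesz_real l e.
rewrite -/p -/q in p_real q_real *.
rewrite -ler_pdivlMr ?divr_gt0// => pq.
have q4 : `|q| ^+ 2 <= 2 ^+ 2.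
  rewrite real_normK//; apply: (@le_trans _ _ (p ^+ 2 + q ^+ 2)).
    by rewrite lerDr real_exprn_even_ge0.
  apply: (le_trans pq); rewrite ler_pdivrMr ?divr_gt0//.
  rewrite (_ : 2 ^+ 2 * (3 / 4) = 1 + 2); last by field.
  by rewrite lerDl.
by rewrite -ler_sqr ?nnegrE.
Qed.

End riesz_products.

(** * Weak nullity *)

Section weakly_null_witnesses.
Variables (K : scalarFieldType) (U : set_system nat) (ultraU : UltraFilter U).
Variables (T1 T2 : topologicalType).
Variables (cT1 : compact [set: T1]) (cT2 : compact [set: T2]).
Variables (X : completeNormedModType K).
Variables (tens : {bilinear contfun K cT1 -> contfun K cT2 -> X}).
Hypothesis projX : projective_tensor_product tens.
Variables (f : nat -> contfun K cT1) (t : nat -> T1).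
Variables (g : nat -> contfun K cT2) (s : nat -> T2).
Hypothesis ft : bumps f t.
Hypothesis gs : bumps g s.

(** At every point the values of the g_k are absolutely summable with sum at
    most 1, a bound that ignores signs. *)
Lemma norm_sign_sum_le (theta : nat -> K) (A : seq nat) e : uniq A ->
  (forall k, `|theta k| <= 1) ->
  `|sign_sum (fun k => theta k *: g k) A e| <= 1.
Proof.
move=> uA th1; apply: supnorm_le => // x.
have le_sum : `|sign_sum (fun k => theta k *: g k) A e x| <= \sum_(k <- A) `|g k x|.
  elim: A e {uA} => [|k A IHA] e; first by rewrite big_nil /= normr0.
  have -> : sign_sum (fun k => theta k *: g k) (k :: A) e x =
    sign_sum (fun k => theta k *: g k) A (behead e) x +
    (-1) ^+ head false e * (theta k * g k x) by [].
  rewrite big_cons addrC (le_trans (ler_normD _ _))// lerD//.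
  by rewrite normrM normrX normrN1 expr1n mul1r normrM ler_piMl.
rewrite (le_trans le_sum)//.
pose N := (\max_(k <- A) k).+1.
apply: le_trans (gs.2 N x); rewrite -(big_mkord predT (fun k => `|g k x|)).
have pA : perm_eq A [seq k <- index_iota 0 N | k \in A].
  apply: uniq_perm => //; first by rewrite filter_uniq// iota_uniq.
  move=> k; rewrite mem_filter mem_index_iota /=.
  case kA: (k \in A) => //=; rewrite ltnS.
  by apply/esym; exact: leq_bigmax_seq.
rewrite (perm_big _ pA) big_filter big_mkcond /=.
by apply: ler_sum => k _; case: ifP.
Qed.

(** The trivial bound is the number m^2 of terms.  The Riesz products, taken at
    each index j with rho_k = r_k (j), exhibit c times the sum as an average of
    elementary tensors whose norms are at most 2, and 2 / c = 4 m. *)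
Lemma norm_rademacher_tens_sum_le (theta : nat -> K) (A : seq nat) m J : (0 < m)%N ->
  uniq A -> size A = (m ^ 2)%N -> (forall k, `|theta k| <= 1) ->
  `|\sum_(k <- A) theta k *: rademacher_tens tens f g J k| <= 4 * m%:R.
Proof.
move=> m0 uA sA th1; pose c : K := (2 * m%:R)^-1.
have c0 : 0 < c by rewrite invr_gt0 mulr_gt0// ltr0n.
pose q e j : K := (riesz c (fun k => rademacher K k j) A e).2.
pose y k := theta k *: g k.
(* For each j, sum_riesz_im replaces the average over e by a sum over k. *)
have sumE : \sum_(e <- signs (size A)) tens (\sum_(j < J) q e j *: f j) (sign_sum y A e)
    = (2 ^+ size A * c) *: \sum_(k <- A) theta k *: rademacher_tens tens f g J k.
  under eq_bigr => e _.
    rewrite linear_sumlz.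
    under eq_bigr => j _ do rewrite linearZl_LR -linearZr_LR.
    over.
  rewrite exchange_big/=.
  under eq_bigr => j _ do rewrite -linear_sumr sum_riesz_im linearZr_LR linear_sumr.
  rewrite -scaler_sumr exchange_big/=; congr (_ *: _); apply: eq_bigr => k _.
  rewrite /rademacher_tens linear_sumlz scaler_sumr; apply: eq_bigr => j _.
  by rewrite !linearZr_LR linearZl_LR !scalerA mulrC.
have := ler_norm_sum (signs (size A))
  (fun e => tens (\sum_(j < J) q e j *: f j) (sign_sum y A e)) predT.
rewrite sumE normrZ normrM normrX normr_nat (gtr0_norm c0) => le_sum.
have : 2 ^+ size A * c * `|\sum_(k <- A) theta k *: rademacher_tens tens f g J k| <=
    2 ^+ size A * 2.
  apply: (le_trans le_sum).
  apply: (@le_trans _ _ (\sum_(e <- signs (size A)) 2)); last first.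
    by rewrite big_const_seq count_predT size_signs iter_addr addr0 -natrX mulr_natl.
  apply: ler_sum => e _; rewrite (le_trans (norm_tens_le projX _ _))//.
  rewrite -[leRHS]mulr1 ler_pM ?norm_sign_sum_le//.
  apply: (norm_bump_sum_le (a := q e) _ ft) => // j.
  apply: (riesz_im_le _ _ _ _ m0 _ sA) => //.
  - exact: gtr0_real.
  - by move=> k; exact: rademacher_real.
  - by move=> k; exact: rademacher_sqr.
rewrite -mulrA ler_pM2l ?exprn_gt0// ler_pdivrMl ?mulr_gt0 ?ltr0n//.
by move=> /le_trans; apply; rewrite mulrAC -[2 * 2]natrM.
Qed.

Variable z : nat -> dual (dual X).
Hypothesis zP : forall k (phi : dual X),
  phi (rademacher_tens tens f g J k) @[J --> U] --> (z k phi : K^o).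

Lemma norm_witness_sum_le (theta : nat -> K) (A : seq nat) m : (0 < m)%N ->
  uniq A -> size A = (m ^ 2)%N -> (forall k, `|theta k| <= 1) ->
  `|\sum_(k <- A) theta k *: z k| <= 4 * m%:R.
Proof.
move=> m0 uA sA th1; apply: dual_norm_le => [|phi]; first by rewrite mulr_ge0.
rewrite dual_sumE.
have cv : (phi (\sum_(k <- A) theta k *: rademacher_tens tens f g J k) : K^o)
    @[J --> U] -->
    (\sum_(k <- A) (theta k *: z k) phi : K^o).
  under eq_fun do rewrite linear_sum.
  apply: (@cvg_sum K K^o nat nat U _ A
    (fun k J => phi (theta k *: rademacher_tens tens f g J k))) => k.
  under eq_fun do rewrite linearZ.
  by apply: cvgZl_tmp; exact: zP.
apply: (@norm_cvg_le K K^o nat U _ _ _ _ cv); apply: nearW => J.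
by rewrite (le_trans (dual_le _ _))// mulrC ler_wpM2r// norm_rademacher_tens_sum_le.
Qed.

(** If |phi (z k)| > e for infinitely many k, sum m^2 of the vectors z k with
    phases that make their values add up: m^2 e < 4 m |phi|, which is false for
    large m. *)
Lemma witnesses_weakly_null (phi : dual (dual (dual X))) :
  (phi (z k) : K^o) @[k --> \oo] --> (0 : K^o).
Proof.
apply/cvgr0Pnorm_le => e e0.
have [m mP] := le_nat_bound (divr_ge0 (mulr_ge0 (ler0n K 4) (normr_ge0 phi)) (ltW e0)).
pose bad k := ~ (`|phi (z k)| <= e).
have [[N NP]|NP] := pselect (exists N, forall k, (N <= k)%N -> `|phi (z k)| <= e).
  by exists N.
have badS N : exists k, (N <= k)%N /\ bad k.
  apply/not_existsP => H; apply: NP; exists N => k Nk.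
  by apply: contrapT => kb; apply: (H k).
have [A [uA sA badA]] : exists A : seq nat,
    [/\ uniq A, size A = (m.+1 ^ 2)%N & forall k, k \in A -> bad k].
  elim: (m.+1 ^ 2)%N => [|n [A [uA sA badA]]]; first by exists [::].
  have [k [Ak kbad]] := badS (\max_(i <- A) i).+1.
  exists (k :: A); split=> /=.
  - rewrite uA andbT; apply/negP => kA.
    have kmax : (k <= \max_(i <- A) i)%N by exact: leq_bigmax_seq.
    by rewrite ltnNge kmax in Ak.
  - by rewrite sA.
  - by move=> i; rewrite inE => /predU1P[->|]; [exact: kbad|exact: badA].
pose theta k := `|phi (z k)| / phi (z k).
have th1 k : `|theta k| <= 1 := (phaseP _).1.
have := dual_le phi (\sum_(k <- A) theta k *: z k).
rewrite linear_sum; under eq_bigr => k _ do rewrite linearZ.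
have -> : \sum_(k <- A) theta k * phi (z k) = \sum_(k <- A) `|phi (z k)|.
  by apply: eq_bigr => k _; exact: (phaseP _).2.
rewrite ger0_norm ?sumr_ge0// => le1.
have le2 : \sum_(k <- A) e < \sum_(k <- A) `|phi (z k)|.
  have := sA; case: A badA {uA sA le1} => // k A badA _.
  have lt_bad i : i \in k :: A -> e < `|phi (z i)|.
    by move=> /badA /negP; rewrite -real_ltNge// ?normr_real; exact: gtr0_real.
  rewrite !big_cons ltr_leD ?lt_bad ?mem_head// big_seq [leRHS]big_seq ler_sum// => i iA.
  by rewrite ltW// lt_bad// inE iA orbT.
have le3 := le_trans le1 (ler_wpM2l (normr_ge0 phi)
  (norm_witness_sum_le (ltn0Sn m) uA sA th1)).
exfalso; move: (lt_le_trans le2 le3).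
rewrite big_const_seq count_predT sA iter_addr addr0 -[e *+ _]mulr_natl natrX.
rewrite [ltLHS](_ : _ = m.+1%:R * (m.+1%:R * e)); last by ring.
rewrite [ltRHS](_ : _ = m.+1%:R * (4 * `|phi|)); last by ring.
rewrite ltr_pM2l ?ltr0n//; apply/negP.
rewrite -real_leNgt ?realM ?normr_real ?gtr0_real ?realn//.
rewrite ler_pdivrMr// in mP; apply: le_trans mP _.
by rewrite ler_wpM2r ?ler_nat// ltW.
Qed.

End weakly_null_witnesses.

(** * Weak compactness in spaces of continuous functions *)

Lemma initial_cvg (S : choiceType) (T : topologicalType) (f : S -> T)
    (F : set_system S) (FF : Filter F) (s : S) :
  f @ F --> f s -> F --> (s : initial_topology f).
Proof.
move=> Ff A; rewrite nbhsE => -[B [[O oO <-] Os] BA].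
by apply: filterS BA _; apply: Ff; exact: open_nbhs_nbhs.
Qed.

Section weak_topology.
Variables (K : scalarFieldType) (V : normedModType K).

Lemma weak_cvg (G : set_system V) (FG : Filter G) (w : V) :
  (forall phi : dual V, (phi v : K^o) @[v --> G] --> (phi w : K^o)) ->
  (G : set_system (weak V)) --> (w : weak V).
Proof.
move=> Gw; apply: initial_cvg; apply/cvg_sup => phi; apply: initial_cvg.
exact: Gw.
Qed.

Lemma weak_eval_continuous (phi : dual V) : continuous (phi : weak V -> K^o).
Proof.
move=> w.
have ic := @initial_continuous _ _
  (fun v : V => (fun phi => phi v) : {ptws dual V -> K^o}) w.
apply: (@cvg_comp _ _ _ _ (fun h : {ptws dual V -> K^o} => h phi) _ _ _ ic).
exact: (@proj_continuous (dual V) (fun=> K^o) phi).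
Qed.

Lemma weak_hausdorff :
  (forall v w : V, (forall phi : dual V, phi v = phi w) -> v = w) ->
  hausdorff_space (weak V).
Proof.
move=> sepV v w vw; apply: sepV => phi.
apply: (@norm_hausdorff K K^o) => A B Av Bw.
have [u [Au Bu]] := vw _ _ (weak_eval_continuous Av) (weak_eval_continuous Bw).
by exists (phi u).
Qed.

End weak_topology.

Section contfun_complete.
Variables (K : scalarFieldType) (T : topologicalType) (cT : compact [set: T]).
Hypothesis ballK : closed_balls_compact K.

(** A uniformly Cauchy filter converges pointwise, since its values at a point
    eventually stay in a compact ball, and the limit is uniform. *)
Lemma contfun_complete (F : set_system (contfun K cT)) :
  ProperFilter F -> cauchy F -> cvg F.
Proof.
move=> FF /cauchy_ballP Fc.
have Fnear e : 0 < e -> exists2 A, F A & forall u v, A u -> A v -> `|u - v| <= e.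
  move=> e0; have [[A B] /= [FA FB] AB] := Fc e e0.
  exists (A `&` B); first exact: filterI.
  move=> u v [Au _] [_ Bv]; have := AB (u, v) (conj Au Bv).
  by rewrite /= -ball_normE => /ltW.
have /choice[h hP] x : exists l : K^o, (u x : K^o) @[u --> F] --> l.
  have [A FA A1] := Fnear 1 ltr01; have [u0 Au0] := filter_ex FA.
  have M0 : 0 <= `|u0 x| + 1 by rewrite addr_ge0.
  apply/cvg_ex; apply: (@compact_cauchy_cvg K^o _ _ _ _ _ (ballK M0)).
    apply/cauchy_ballP => e e0; have [B FB Be] := Fnear (e / 2) (divr_gt0 e0 (ltr0n _ 2)).
    pose C : set K^o := [set u x | u in B].
    have FC : F ((fun u : contfun K cT => u x : K^o) @^-1` C).
      by apply: filterS FB => u Bu; exists u.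
    exists (C, C); first by split.
    move=> [_ _] /= [[u Bu <-] [v Bv <-]].
    rewrite -ball_normE /=.
    apply: le_lt_trans (_ : e / 2 < e); last by rewrite ltr_pdivrMr// ltr_pMr// ltr1n.
    by apply: le_trans (Be _ _ Bu Bv); exact: (contfun_le (u - v)).
  suff : F [set u : contfun K cT | `|u x| <= `|u0 x| + 1] by [].
  apply: filterS FA => u Au /=; rewrite -(subrK (u0 x) (u x)) addrC.
  rewrite (le_trans (ler_normD _ _))// lerD2l.
  by apply: le_trans (A1 _ _ Au Au0); exact: (contfun_le (u - u0)).
have hA e A u : F A -> (forall u v, A u -> A v -> `|u - v| <= e) -> A u ->
    forall x, `|h x - u x| <= e.
  move=> FA Ae Au x.
  have cv : (v x - u x : K^o) @[v --> F] --> (h x - u x : K^o).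
    by apply: cvgB => //; exact: cvg_cst.
  apply: (@norm_cvg_le K K^o _ F _ _ _ _ cv); apply: filterS FA => v Av.
  by apply: le_trans (Ae _ _ Av Au); exact: (contfun_le (v - u)).
have hc : continuous (h : T -> K^o).
  move=> x; apply/cvgrPdist_le => e e0.
  have e3 : 0 < e / 3 by rewrite divr_gt0.
  have [A FA Ae] := Fnear _ e3; have [u Au] := filter_ex FA.
  have := @contfun_continuous _ _ _ u x => /cvgrPdist_le /(_ _ e3).
  apply: filterS => y uxy.
  rewrite (_ : h x - h y = (h x - u x) + (u x - u y) - (h y - u y)); last by ring.
  rewrite (_ : e = e / 3 + e / 3 + e / 3); last by field.
  rewrite (le_trans (ler_normB _ _))// lerD ?(hA _ A)//.
  by rewrite (le_trans (ler_normD _ _))// lerD ?(hA _ A).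
have hin : (h : T -> K^o) \in @continuous_pred K T by rewrite inE.
apply/cvg_ex; exists (Contfun cT hin); apply/cvgrPdist_le => e e0.
have [A FA Ae] := Fnear _ e0; apply: (filterS _ FA) => u Au.
by apply: supnorm_le => [|x]; [exact: ltW | exact: (hA _ _ _ FA Ae Au x)].
Qed.

End contfun_complete.

(** Take p such that the p-th partial sum exceeds the supremum of all of them
    minus e. *)
Lemma nneg_sum_tail (K : scalarFieldType) (c : nat -> K) (M e : K) :
  (forall l, 0 <= c l) -> (forall m, \sum_(l < m) c l <= M) -> 0 < e ->
  exists p, forall q, \sum_(p <= l < q) c l <= e.
Proof.
move=> c0 cM e0; pose A := range (fun m => \sum_(l < m) c l).
have A0 : A !=set0 by exists (\sum_(l < 0) c l), 0%N.
have Age0 x : A x -> 0 <= x by case=> m _ <-; exact: sumr_ge0.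
have ubA : has_ubound A by exists M => _ [m _ <-].
pose s := supremum 0 A.
have s_ge m : \sum_(l < m) c l <= s by apply: nneg_supremum_ub => //; exists m.
have sreal : s \is Num.real by rewrite ger0_real// (le_trans _ (s_ge 0%N)) ?big_ord0.
have [p pP] : exists p, s - e < \sum_(l < p) c l.
  apply/not_existsP => H.
  have : s <= s - e.
    apply: nneg_supremum_le => // _ [m _ <-]; have /negP := H m.
    have Sreal : \sum_(l < m) c l \is Num.real by rewrite ger0_real ?sumr_ge0.
    have sereal : s - e \is Num.real by rewrite rpredB// gtr0_real.
    by rewrite -real_leNgt.
  by rewrite lerDl oppr_ge0 lt_geF.
exists p => q; have [pq|qp] := leqP p q; last by rewrite big_geq ?ltW// ltnW.
have := s_ge q; rewrite -(big_mkord predT c) (big_cat_nat (n := p))//= big_mkord.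
move=> sq; rewrite -(lerD2l (\sum_(l < p) c l)) (le_trans sq)//.
by rewrite -lerBlDr ltW.
Qed.

Section ell2_ball.
Variables (K : scalarFieldType) (T : topologicalType) (cT : compact [set: T]).
Hypothesis ballK : closed_balls_compact K.
Variables (f : nat -> contfun K cT) (t : nat -> T).
Hypothesis ft : bumps f t.

Lemma eval_functional x : exists phi : dual (contfun K cT), forall u, phi u = u x.
Proof.
apply: (@bounded_linear_dual _ _ (fun u : contfun K cT => u x) 1).
  by move=> a u v.
by move=> u; rewrite mul1r contfun_le.
Qed.

Lemma sqr_term_le (a : nat -> K) (M : K) l : 0 <= M ->
  (forall m, \sum_(l < m) `|a l| ^+ 2 <= M ^+ 2) -> `|a l| <= M.
Proof.
move=> M0 /(_ l.+1); rewrite big_ord_recr/= => aM.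
rewrite -ler_sqr ?nnegrE//; apply: le_trans aM.
by rewrite lerDr sumr_ge0// => i _; rewrite exprn_ge0.
Qed.

(** A square-summable sequence tends to 0, and on the copy of c_0 spanned by the
    f_l the norm of a tail is the supremum of its coefficients. *)
Lemma bump_series_cvg (a : nat -> K) (M : K) :
  (forall m, \sum_(l < m) `|a l| ^+ 2 <= M) ->
  exists w : contfun K cT, \sum_(l < m) a l *: f l @[m --> \oo] --> w.
Proof.
move=> aM; apply/cvg_ex; apply: contfun_complete => //.
apply/cauchy_exP => e e0.
have e2 : 0 < e / 2 by rewrite divr_gt0.
have [p pP] := nneg_sum_tail (fun l => exprn_ge0 2 (normr_ge0 (a l))) aM
  (exprn_gt0 2 e2).
exists (\sum_(l < p) a l *: f l); exists p => // q /= pq.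
rewrite -ball_normE /= distrC.
apply: le_lt_trans (_ : e / 2 < e); last by rewrite ltr_pdivrMr// ltr_pMr// ltr1n.
pose b l := if (l < p)%N then 0 else a l.
have -> : \sum_(l < q) a l *: f l - \sum_(l < p) a l *: f l = \sum_(l < q) b l *: f l.
  rewrite -!(big_mkord predT (fun l => a l *: f l)).
  rewrite -(big_mkord predT (fun l => b l *: f l)) (big_cat_nat (n := p))//=.
  rewrite [in RHS](big_cat_nat (n := p))//= addrAC subrr add0r.
  rewrite (_ : \sum_(0 <= l < p) b l *: f l = 0) ?add0r; last first.
    by rewrite big_mkord big1// => l _; rewrite /b ltn_ord scale0r.
  by apply: eq_big_nat => l /andP[pl _]; rewrite /b ltnNge pl.
apply: (norm_bump_sum_le _ ft) => [|l]; first exact: ltW.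
rewrite /b; case: ltnP => [_|pl]; first by rewrite normr0 ltW.
rewrite -ler_sqr ?nnegrE ?(ltW e2)//; apply: le_trans (pP l.+1).
by rewrite big_nat_recr//= lerDr sumr_ge0// => i _; rewrite exprn_ge0.
Qed.

Lemma bump_series_eval (a : nat -> K) w l :
  \sum_(l < m) a l *: f l @[m --> \oo] --> (w : contfun K cT) -> w (t l) = a l.
Proof.
move=> aw; have [phi phiE] := eval_functional (t l).
have cv : (phi (\sum_(l < m) a l *: f l) : K^o) @[m --> \oo] --> (w (t l) : K^o).
  rewrite -phiE; apply: (cvg_comp _ _ aw); exact: dual_continuous.
apply: (@cvg_unique K^o (@norm_hausdorff K K^o) _ _ _ _ cv).
apply: cvg_near_cst; exists l.+1 => // m /= lm.
by rewrite phiE (bump_sum_eval a ft lm).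
Qed.

(** The restriction of phi to the copy of c_0 belongs to l_1. *)
Lemma sum_dual_bump_le (phi : dual (contfun K cT)) m :
  \sum_(l < m) `|phi (f l)| <= `|phi|.
Proof.
pose a l := `|phi (f l)| / phi (f l).
have -> : \sum_(l < m) `|phi (f l)| = `|phi (\sum_(l < m) a l *: f l)|.
  rewrite linear_sum.
  rewrite -[LHS]ger0_norm ?sumr_ge0//; congr `|_|; apply: eq_bigr => l _.
  by rewrite linearZ; exact/esym/(phaseP _).2.
rewrite (le_trans (dual_le _ _))// ler_piMr//.
by apply: (norm_bump_sum_le _ ft) => // l; exact: (phaseP _).1.
Qed.

(** The unit ball of l_2 inside the copy of c_0 spanned by the f_l, described
    through the coordinates w (t l). *)
Definition ell2_ball : set (contfun K cT) := [set w : contfun K cT |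
  (forall m, \sum_(l < m) `|w (t l)| ^+ 2 <= 1) /\
  (\sum_(l < m) w (t l) *: f l @[m --> \oo] --> w)].

Lemma ell2_ball_coord_le w l : ell2_ball w -> `|w (t l)| <= 1.
Proof.
move=> [w1 _]; apply: (@sqr_term_le (fun l => w (t l)) 1 l ler01) => m.
by rewrite expr1n.
Qed.

(** On the ball the series of phi is dominated term by term by the |phi (f l)|,
    hence converges uniformly. *)
Lemma ell2_ball_tail w (phi : dual (contfun K cT)) p (e : K) : ell2_ball w ->
  (forall q, \sum_(p <= l < q) `|phi (f l)| <= e) ->
  `|phi w - \sum_(l < p) w (t l) * phi (f l)| <= e.
Proof.
move=> wB tail; have [_ ww] := wB.
have cv : (phi (\sum_(l < m) w (t l) *: f l) - \sum_(l < p) w (t l) * phi (f l) : K^o)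
    @[m --> \oo] --> (phi w - \sum_(l < p) w (t l) * phi (f l) : K^o).
  apply: cvgB; last exact: cvg_cst.
  by apply: (cvg_comp _ _ ww); exact: dual_continuous.
apply: (@norm_cvg_le K K^o nat \oo _ _ _ _ cv); exists p => // m /= pm.
have -> : phi (\sum_(l < m) w (t l) *: f l) = \sum_(l < m) w (t l) * phi (f l).
  by rewrite linear_sum; apply: eq_bigr => l _; rewrite linearZ.
rewrite -!(big_mkord predT (fun l => w (t l) * phi (f l))).
rewrite (big_cat_nat (n := p))//= addrAC subrr add0r.
rewrite (le_trans (ler_norm_sum _ _ _))//; apply: le_trans (tail m).
by apply: ler_sum => l _; rewrite normrM ler_piMl// ell2_ball_coord_le.
Qed.

(** The coordinates w (t l) converge along G, and their limits define a point
    wb of the ball.  By the uniform smallness of the tails, phi is on the ball a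
    uniform limit of functions of finitely many coordinates, so that its values
    converge as well. *)
Lemma ell2_ball_ultra (G : set_system (contfun K cT)) :
  UltraFilter G -> G ell2_ball -> exists2 wb, ell2_ball wb &
    forall phi : dual (contfun K cT), (phi w : K^o) @[w --> G] --> (phi wb : K^o).
Proof.
move=> ultraG GB.
have /choice[b bP] l : exists bl : K^o,
    (fun w : contfun K cT => w (t l) : K^o) @ G --> bl.
  apply: (bounded_ultra_cvg ballK ultraG ler01).
  by apply: filterS GB => w; exact: ell2_ball_coord_le.
have b1 m : \sum_(l < m) `|b l| ^+ 2 <= 1.
  have cv : (fun w : contfun K cT => \sum_(l < m) `|w (t l)| ^+ 2 : K^o) @ G -->
      (\sum_(l < m) `|b l| ^+ 2 : K^o).
    apply: (@cvg_sum K K^o _ 'I_m G _ _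
      (fun l (w : contfun K cT) => `|w (t l)| ^+ 2) (fun l => `|b l| ^+ 2)) => l.
    rewrite -[X in _ --> X]/(`|b l| * `|b l|).
    by apply: cvgM; apply: cvg_norm; exact: bP.
  rewrite -[leLHS]ger0_norm; last by apply: sumr_ge0 => l _; rewrite exprn_ge0.
  apply: (@norm_cvg_le K K^o _ G _ _ _ _ cv); apply: filterS GB => w [w1 _].
  by rewrite ger0_norm// sumr_ge0// => l _; rewrite exprn_ge0.
have [wb wbP] := bump_series_cvg b1.
have wbE l : wb (t l) = b l by exact: bump_series_eval wbP.
have wbB : ell2_ball wb.
  split=> [m|]; first by under eq_bigr => l _ do rewrite wbE.
  by under eq_fun => m do under eq_bigr => l _ do rewrite wbE.
exists wb => // phi.
apply/cvgrPdist_le => e e0; have e3 : 0 < e / 3 by rewrite divr_gt0.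
have [p pP] := nneg_sum_tail (fun l => normr_ge0 (phi (f l)))
  (sum_dual_bump_le phi) e3.
have cv : (fun w : contfun K cT => \sum_(l < p) w (t l) * phi (f l) : K^o) @ G -->
    (\sum_(l < p) wb (t l) * phi (f l) : K^o).
  apply: (@cvg_sum K K^o _ 'I_p G _ _
    (fun l (w : contfun K cT) => w (t l) * phi (f l))
    (fun l => wb (t l) * phi (f l))) => l.
  by apply: cvgMr_tmp; rewrite wbE; exact: bP.
have /cvgrPdist_le /(_ _ e3) cvle := cv.
apply: (@filterS2 _ G _ _ _ _ _ GB cvle) => w wB le3.
rewrite (_ : phi wb - phi w = (phi wb - \sum_(l < p) wb (t l) * phi (f l)) +
  (\sum_(l < p) wb (t l) * phi (f l) - \sum_(l < p) w (t l) * phi (f l)) -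
  (phi w - \sum_(l < p) w (t l) * phi (f l))); last by ring.
rewrite (_ : e = e / 3 + e / 3 + e / 3); last by field.
rewrite (le_trans (ler_normB _ _))// lerD ?ell2_ball_tail//.
by rewrite (le_trans (ler_normD _ _))// lerD ?ell2_ball_tail.
Qed.

Lemma ell2_ball_compact : compact (ell2_ball : set (weak (contfun K cT))).
Proof.
rewrite compact_ultra => G ultraG GB.
have [w wB Gw] := @ell2_ball_ultra G ultraG GB.
by exists w; split => //; apply: (@weak_cvg K _ G _ w).
Qed.

Lemma ell2_ball_precompact : precompact (ell2_ball : set (weak (contfun K cT))).
Proof.
apply: compact_precompact ell2_ball_compact; apply: weak_hausdorff => u v uv.
apply/val_inj/funext => x; have [phi phiE] := eval_functional x.
by have := uv phi; rewrite !phiE.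
Qed.

End ell2_ball.

(** * A criterion for failing the Dunford-Pettis property *)

Section not_dunford_pettis.
Variables (K : scalarFieldType) (T : topologicalType) (cT : compact [set: T]).
Hypothesis ballK : closed_balls_compact K.
Variables (f : nat -> contfun K cT) (t : nat -> T).
Hypothesis ft : bumps f t.

(** A space fails the Dunford-Pettis property as soon as it has functionals
    Phi_l forming a bounded operator into l_2, and a weakly null sequence that
    this operator maps to the unit vectors: compose with the inclusion of l_2
    into c_0, which is weakly compact. *)
Lemma not_dunford_pettis (V : normedModType K) (Phi : nat -> dual V) (z : nat -> V) :
  (forall w (M : K) m, 0 < M -> `|w| <= M -> \sum_(l < m) `|Phi l w| ^+ 2 <= M ^+ 2) ->
  (forall k l, Phi l (z k) = (k == l)%:R) ->
  (forall phi : dual V, (phi (z k) : K^o) @[k --> \oo] --> (0 : K^o)) ->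
  ~ dunford_pettis V.
Proof.
move=> Phi2 Phiz z0 DP.
have normw (w : V) : 0 < `|w| + 1 by rewrite ltr_wpDl.
have Phi2' w m : \sum_(l < m) `|Phi l w| ^+ 2 <= (`|w| + 1) ^+ 2.
  by apply: Phi2 => //; rewrite lerDl.
pose W : completeNormedModType K := HB.pack (contfun K cT)
  (Uniform_isComplete.Build (contfun K cT) (@contfun_complete K T cT ballK)).
(* L is the composition of (Phi_l) : V -> l_2, of the inclusion of l_2 into c_0
   and of the embedding of c_0 into C(T) by means of the f_l. *)
have /choice[L LP] (w : V) : exists v : contfun K cT,
    \sum_(l < m) Phi l w *: f l @[m --> \oo] --> v.
  exact: (bump_series_cvg ballK ft (a := fun l => Phi l w) (Phi2' w)).
have Luniq w v : \sum_(l < m) Phi l w *: f l @[m --> \oo] --> v -> L w = v.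
  move=> wv.
  exact: (@cvg_unique _ (@norm_hausdorff K (contfun K cT)) _ _ _ _ (LP w) wv).
have linL : linear (L : V -> W).
  move=> a u v; apply: Luniq.
  rewrite (_ : (fun m => _) = (fun m => a *: (\sum_(l < m) Phi l u *: f l) +
      \sum_(l < m) Phi l v *: f l)).
    by apply: cvgD => //; apply: cvgZl_tmp.
  apply/funext => m; rewrite scaler_sumr -big_split; apply: eq_bigr => l _ /=.
  by rewrite linearP scalerDl scalerA.
pose LL : {linear V -> W} := HB.pack (L : V -> W)
  (GRing.isLinear.Build K V W *:%R (L : V -> W) linL).
have L_le w : `|L w| <= `|w| + 1.
  apply: (@norm_cvg_le K (contfun K cT) nat \oo _ _ _ _ (LP w)); apply: nearW => m.
  apply: (norm_bump_sum_le (a := fun l => Phi l w) _ ft) => [|l]; first exact: ltW.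
  by apply: (@sqr_term_le _ (fun l => Phi l w)); [exact: ltW | exact: Phi2'].
have cL : continuous LL.
  apply: (@bounded_linear_continuous _ _ _ LL); apply/bounded_funP => r.
  by exists (r + 1) => w wr; apply: (le_trans (L_le w)); rewrite lerD2r.
have wcL : weakly_compact_operator LL.
  split=> //; apply: precompact_subset (ell2_ball_precompact ballK ft).
  move=> _ [w /= w1 <-].
  have LE l : L w (t l) = Phi l w.
    exact: (@bump_series_eval K T cT f t ft (fun l => Phi l w) (L w) l (LP w)).
  split=> [m|].
    under eq_bigr => l _ do rewrite LE.
    by rewrite -[leRHS](expr1n _ 2); apply: Phi2.
  by under eq_fun => m do under eq_bigr => l _ do rewrite LE; exact: LP.
have Lz k : L (z k) = f k.
  apply: Luniq; apply: cvg_near_cst; exists k.+1 => // m /= km.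
  rewrite (bigD1 (Ordinal km))//= Phiz eqxx scale1r big1 ?addr0// => l lk.
  have /negPf kl : k != l by apply: contra lk => /eqP kl; apply/eqP/val_inj.
  by rewrite Phiz kl scale0r.
have [_ /(_ z) cc] := DP W LL wcL.
have /cc/cauchy_ballP/(_ 1 ltr01) : weakly_cauchy z.
  by move=> phi; apply: cvg_cauchy; apply/cvg_ex; exists 0; exact: z0.
move=> [[A B] /= [[N1 _ AN] [N2 _ BN]] AB].
pose n := maxn N1 N2.
have An : A (LL (z n)) by apply: AN; rewrite /= leq_maxl.
have Bn : B (LL (z n.+1)) by apply: BN; rewrite /= leqW// leq_maxr.
have := AB (_, _) (conj An Bn); rewrite /= -ball_normE /= !Lz => lt1.
have := le_lt_trans (contfun_le (f n - f n.+1) (t n)) lt1.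
rewrite -[X in `|X|]/(f n (t n) - f n.+1 (t n)) !ft.1 eqxx.
by rewrite (_ : (n == n.+1) = false) ?subr0 ?normr1 ?ltxx// ltn_eqF.
Qed.

End not_dunford_pettis.

(** * Bumps on infinite compact spaces *)

Section disjoint_open_sets.
Variable T : topologicalType.
Hypothesis hausT : hausdorff_space T.

(** Separate two points x, y of O by open sets A, B.  If the complement of the
    closure of A is infinite in O, cut off A; otherwise the part of B in O is
    finite, which makes y an isolated point, and {y} can be cut off. *)
Lemma infinite_open_split (O : set T) : open O -> infinite_set O ->
  exists U O' : set T, [/\ open U, U !=set0, open O', infinite_set O' &
    [/\ U `<=` O, O' `<=` O & U `&` O' = set0]].
Proof.
move=> oO iO.
have [x Ox] := infinite_setN0 iO.
have [y [Oy xy]] : (O `\` [set x]) !=set0.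
  by apply: infinite_setN0; apply: infinite_setD.
have {}xy : x != y by apply/eqP => xy'; exact: xy.
have := hausT; rewrite open_hausdorff => /(_ x y xy)[[A B] /= [xA yB] [oA oB /eqP AB]].
rewrite !inE in xA yB.
have [fin|inf] := pselect (finite_set (O `\` closure A)); last first.
  exists (A `&` O), (O `\` closure A); split => //.
  - exact: openI.
  - by exists x.
  - by apply: openI => //; exact/closed_openC/closed_closure.
  split; [exact: subIsetr | exact: subDsetl |].
  by rewrite -subset0 => z [[Az _] [_]]; apply; exact: subset_closure.
pose V := B `&` O.
have VA : V `<=` O `\` closure A.
  move=> z [Bz Oz]; split => // /(_ B)[|w [Aw Bw]].
    exact: open_nbhs_nbhs.
  by have : (A `&` B) w by []; rewrite AB.
have finV : finite_set V := sub_finite_set VA fin.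
have clfin := accessible_finite_set_closed.1 (hausdorff_accessible hausT).
have oy : open [set y].
  have -> : [set y] = V `&` ~` (V `\ y).
    apply/seteqP; split => [_ ->|z [Vz /not_andP[]//]].
      by split=> // -[_]; apply.
    by move=> /contrapT.
  apply: openI; first exact: openI.
  by apply: closed_openC; apply: clfin; exact: finite_setD.
exists [set y], (O `\ y); split => //.
- by exists y.
- apply: openI => //; apply: closed_openC; apply: clfin; exact: finite_set1.
- exact: infinite_setD.
split; [by move=> _ ->|exact: subDsetl|].
by rewrite -subset0 => z [-> [_]]; apply.
Qed.

(** Iterate the splitting: U n is cut off from the current infinite open set
    O n, and all later U m are subsets of what is left. *)
Lemma infinite_disjoint_opens : infinite_set [set: T] ->
  exists U : nat -> set T, [/\ forall n, open (U n), forall n, U n !=set0 &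
    forall m n, m != n -> U m `&` U n = set0].
Proof.
move=> infT; pose S := {O : set T | open O /\ infinite_set O}.
have /choice[step stepP] (s : S) : exists p : set T * S,
    [/\ open p.1, p.1 !=set0, p.1 `<=` sval s, sval p.2 `<=` sval s &
      p.1 `&` sval p.2 = set0].
  case: s => O [oO iO] /=.
  have [U [O' [oU U0 oO' iO' [UO O'O UO']]]] := infinite_open_split oO iO.
  by exists (U, exist _ O' (conj oO' iO')).
pose O n : S := iter n (fun s => (step s).2) (exist _ setT (conj openT infT)).
pose U n := (step (O n)).1.
have Odec n d : sval (O (n + d)%N) `<=` sval (O n).
  elim: d => [|d IHd]; first by rewrite addn0.
  rewrite addnS; apply: subset_trans IHd.
  by have [_ _ _ + _] := stepP (O (n + d)%N).
have Ult m n : (m < n)%N -> U m `&` U n = set0.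
  move=> mn; rewrite -subset0 => x [Um Un].
  have [_ _ _ _ <-] := stepP (O m); split => //.
  apply: (Odec m.+1 (n - m.+1)%N); rewrite subnKC//.
  by have [_ _ + _ _] := stepP (O n); apply.
exists U; split => [n|n|m n].
- by have [] := stepP (O n).
- by have [] := stepP (O n).
- by rewrite neq_ltn => /orP[/Ult//|/Ult]; rewrite setIC.
Qed.

End disjoint_open_sets.

Section bump_functions.
Variables (R : realType) (T : topologicalType).
Hypothesis cT : compact [set: T].
Hypothesis hausT : hausdorff_space T.
Hypothesis infT : infinite_set [set: T].

Lemma real_bumps_exist : exists (f : nat -> T -> R) (t : nat -> T),
  [/\ forall j, continuous (f j), forall i j, f j (t i) = (i == j)%:R &
    forall N x, \sum_(j < N) `|f j x| <= 1].
Proof.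
have [U [oU U0 disjU]] := infinite_disjoint_opens hausT infT.
have /choice[t tU] := U0.
have normT : normal_space T := compact_normal hausT cT.
have /choice[f fP] j : exists f : T -> R, [/\ continuous f, range f `<=` `[0, 1],
    f @` (~` U j) `<=` [set 0] & f @` [set t j] `<=` [set 1]].
  apply/uniform_separatorP; apply: (normal_separatorP (R := R)).1 => //.
  - exact: open_closedC.
  - have clfin := accessible_finite_set_closed.1 (hausdorff_accessible hausT).
    by apply: clfin; exact: finite_set1.
  - by rewrite -subset0 => x [Ux xt]; apply: Ux; rewrite xt.
have f0 j x : ~ U j x -> f j x = 0.
  by move=> Ujx; have [_ _ + _] := fP j; apply; exists x.
exists f, t; split => [j|i j|N x]; first by have [] := fP j.
- have [->|ij] := eqVneq i j.
    by have [_ _ _] := fP j; apply; exists (t j).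
  by apply: f0 => Uji; have : (U i `&` U j) (t i) by []; rewrite disjU.
have f1 j : `|f j x| <= 1.
  have [_ + _ _] := fP j => /(_ (f j x)); rewrite /= in_itv /=.
  by case/(_ (imageT _ _))/andP => f_ge0 f_le1; rewrite ger0_norm.
have [[j0 Uj0]|nU] := pselect (exists j : 'I_N, U j x).
  rewrite (bigD1 j0)//= big1 ?addr0// => j jj0.
  rewrite f0 ?normr0// => Ujx; have : (U j `&` U j0) x by [].
  by rewrite disjU.
rewrite big1 ?ler01// => j _; rewrite f0 ?normr0// => Ujx.
by apply: nU; exists j.
Qed.

(** The bumps over any scalar field are images of real ones. *)
Lemma bumps_exist (K : scalarFieldType) (iota : R -> K) :
  continuous (iota : R -> K^o) -> iota 0 = 0 -> iota 1 = 1 ->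
  (forall N (a : nat -> R), \sum_(j < N) `|a j| <= 1 ->
    \sum_(j < N) `|iota (a j)| <= 1) ->
  exists (f : nat -> contfun K cT) (t : nat -> T), bumps f t.
Proof.
move=> ciota iota0 iota1 iota_sum.
have [f [t [cf ft f1]]] := real_bumps_exist.
have fin j : (iota \o f j : T -> K^o) \in @continuous_pred K T.
  have ci : continuous (iota \o f j : T -> K^o).
    by move=> x; apply: continuous_comp; [exact: cf | exact: ciota].
  by rewrite inE.
exists (fun j => Contfun cT (fin j)), t; split => [i j|N x] /=.
  by rewrite ft; case: eqP.
exact: (iota_sum N (fun j => f j x)).
Qed.

End bump_functions.

(** * Real and complex scalars *)

Section real_and_complex_scalars.
Variable R : realType.

Lemma real_closed_balls_compact : closed_balls_compact R.
Proof.
move=> M M0; rewrite (_ : [set x | _] = `[- M, M]%classic).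
  exact: segment_compact.
by apply/seteqP; split => x /=; rewrite in_itv /= -ler_norml.
Qed.

Lemma real_parallelogram : parallelogram_law R.
Proof. by move=> a b; rewrite !real_normK ?num_real//; ring. Qed.

Local Open Scope complex_scope.

Lemma complex_parallelogram : parallelogram_law R[i].
Proof. by move=> a b; rewrite !sqr_normc !rmorphD rmorphN; ring. Qed.

Lemma norm_realC (x : R) : `|x%:C| = `|x|%:C.
Proof. by rewrite normc_def /= expr0n addr0 sqrtr_sqr. Qed.

Lemma realC_continuous : continuous ((fun x => x%:C) : R -> R[i]^o).
Proof.
move=> x; apply/cvgrPdist_le => e e0.
have [eE er] : e = (complex.Re e)%:C /\ 0 < complex.Re e.
  by move: e0; case: e => a b; rewrite ltcE /= => /andP[/eqP -> a0].
have : (fun y : R => y) y @[y --> x] --> x by exact: cvg_id.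
move=> /cvgrPdist_le /(_ _ er); apply: filterS => y xy.
by rewrite -rmorphB norm_realC eE lecR.
Qed.

Lemma normc_ge_Im (x : R[i]) : `|complex.Im x|%:C <= `|x|.
Proof.
have := normc_ge_Re (x * 'i); rewrite ReiNIm normrN normrM.
by rewrite [`|'i|]normc_def /= expr0n expr1n add0r sqrtr1 mulr1.
Qed.

(** Along an ultrafilter the real and imaginary parts converge separately, by
    compactness of the real balls. *)
Lemma complex_closed_balls_compact : closed_balls_compact R[i].
Proof.
move=> M M0; rewrite compact_ultra => G ultraG GM.
have [ME Mr] : M = (complex.Re M)%:C /\ 0 <= complex.Re M.
  by move: M0; case: (M) => a b; rewrite lecE /= => /andP[/eqP -> a0].
have [a aP] : exists a : R^o, (fun z : R[i] => complex.Re z : R^o) @ G --> a.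
  apply: (bounded_ultra_cvg real_closed_balls_compact ultraG Mr).
  apply: filterS GM => z zM; rewrite -lecR -ME.
  exact: le_trans (normc_ge_Re z) zM.
have [b bP] : exists b : R^o, (fun z : R[i] => complex.Im z : R^o) @ G --> b.
  apply: (bounded_ultra_cvg real_closed_balls_compact ultraG Mr).
  apply: filterS GM => z zM; rewrite -lecR -ME.
  exact: le_trans (normc_ge_Im z) zM.
have cv : (id : R[i] -> R[i]^o) @ G --> (a +i* b : R[i]^o).
  have -> : id = (fun z : R[i] => (complex.Re z)%:C + 'i%C * (complex.Im z)%:C).
    by apply/funext => z; rewrite [LHS]complexE.
  rewrite [X in _ --> X]complexE /=.
  apply: cvgD.
    by apply: (cvg_comp _ _ aP); exact: realC_continuous.
  apply: cvgMl_tmp; apply: (cvg_comp _ _ bP); exact: realC_continuous.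
exists (a +i* b); split; last exact: cv.
by apply: (@norm_cvg_le _ R[i]^o _ G _ _ _ _ cv).
Qed.

Lemma real_bumps (T : topologicalType) (cT : compact [set: T]) :
  hausdorff_space T -> infinite_set [set: T] ->
  exists (f : nat -> contfun R cT) (t : nat -> T), bumps f t.
Proof.
move=> hausT infT.
by apply: (bumps_exist cT hausT infT (iota := idfun)) => // x; exact: cvg_id.
Qed.

Lemma complex_bumps (T : topologicalType) (cT : compact [set: T]) :
  hausdorff_space T -> infinite_set [set: T] ->
  exists (f : nat -> contfun R[i] cT) (t : nat -> T), bumps f t.
Proof.
move=> hausT infT.
apply: (bumps_exist cT hausT infT (iota := fun x : R => x%:C)) => //.
  exact: realC_continuous.
move=> N a a1; under eq_bigr => j _ do rewrite norm_realC.
by rewrite -rmorph_sum /= lecR.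
Qed.

End real_and_complex_scalars.

(** * The bidual of the projective tensor product *)

Lemma bidual_projective_not_dunford_pettis (K : scalarFieldType)
    (T1 T2 : topologicalType)
    (cT1 : compact [set: T1]) (cT2 : compact [set: T2])
    (f : nat -> contfun K cT1) (t : nat -> T1)
    (g : nat -> contfun K cT2) (s : nat -> T2)
    (X : completeNormedModType K)
    (tens : {bilinear contfun K cT1 -> contfun K cT2 -> X}) :
  closed_balls_compact K -> parallelogram_law K -> bumps f t -> bumps g s ->
  projective_tensor_product tens -> ~ dunford_pettis (dual (dual X)).
Proof.
move=> ballK par ft gs projX.
have [U [ultraU UN]] := ultraFilterLemma eventually_filter.
have [D DE] := point_functionals ballK projX t s.
have [Phi PhiP] := coordinates_exist ballK ultraU projX DE.
have [z zP] := witnesses_exist ballK ultraU projX ft gs.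
apply: (not_dunford_pettis ballK ft (Phi := Phi) (z := z)).
- by move=> w M m; exact: (coordinates_sqr_le par ultraU UN projX DE PhiP).
- by move=> k l; exact: (coordinates_witnesses ultraU UN ft gs DE PhiP zP).
- by move=> phi; exact: (witnesses_weakly_null ultraU projX ft gs zP).
Qed.

Theorem corollary11 (R : realType) (K1 K2 : topologicalType)
  (cptK1 : compact [set: K1]) (cptK2 : compact [set: K2])
  (hausK1 : hausdorff_space K1) (hausK2 : hausdorff_space K2)
  (infK1 : infinite_set [set: K1]) (infK2 : infinite_set [set: K2]) :
  (forall (X : completeNormedModType R)
      (tens : {bilinear contfun R cptK1 -> contfun R cptK2 -> X}),
    projective_tensor_product tens -> ~ dunford_pettis (dual (dual X))) /\
  (forall (X : completeNormedModType R[i])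
      (tens : {bilinear contfun R[i] cptK1 -> contfun R[i] cptK2 -> X}),
    projective_tensor_product tens -> ~ dunford_pettis (dual (dual X))).
Proof.
split=> X tens.
- have [f [t ft]] := real_bumps R cptK1 hausK1 infK1.
  have [g [s gs]] := real_bumps R cptK2 hausK2 infK2.
  apply: bidual_projective_not_dunford_pettis ft gs.
    exact: real_closed_balls_compact.
  exact: real_parallelogram.
- have [f [t ft]] := complex_bumps R cptK1 hausK1 infK1.
  have [g [s gs]] := complex_bumps R cptK2 hausK2 infK2.
  apply: bidual_projective_not_dunford_pettis ft gs.
    exact: complex_closed_balls_compact.
  exact: complex_parallelogram.
Qed.
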